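(* Let $m$ be a positive integer and let $X$ be a compact subset of $\mathbb{R}^m$. If $X$ is uncountable, then the set \[ \{ f \in C_1(X) : \dim_{\mathrm H} G_f = \dim_{\mathrm H} X + 1 \} \] is a prevalent subset of $C_1(X)$. If $X$ is finite or countable, then $\dim_{\mathrm H} G_f = 0$ for all $f \in C_1(X)$.
   Context: $C_1(X)$ is the Banach space of all continuous functions $f\colon X\to\mathbb{R}$ with the supremum norm. The graph of $f$ is $G_f=\{(x,f(x)):x\in X\}\subseteq X\times\mathbb{R}\subseteq\mathbb{R}^{m+1}$. $\dim_{\mathrm H}$ is Hausdorff dimension, $\dim_{\mathrm H}F=\inf\{s\geq 0:\mathcal{H}^s(F)=0\}$ (equal to $0$ for the empty set). Prevalence: for a Banach space $E$, a Borel set $S\subseteq E$ is shy if there is a compactly supported Borel probability measure $\mu$ on $E$ such that $\mu(S+x)=0$ for all $x\in E$. A non-Borel set is shy if it is contained in a shy Borel set. The complement of a shy set is called prevalent. *)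

(* Defs.v *)
From HB Require Import structures.
From mathcomp Require Import all_boot all_order all_algebra.
From mathcomp Require Import all_classical all_reals all_analysis.

Set Implicit Arguments.
Unset Strict Implicit.
Unset Printing Implicit Defensive.

Import Order.TTheory GRing.Theory Num.Theory.
Import numFieldNormedType.Exports.

Local Open Scope classical_set_scope.
Local Open Scope ring_scope.

Lemma continuous_lincomb {R : realType} {Y : topologicalType} (a : R)
    (f g : Y -> R) :
  continuous f -> continuous g -> continuous (a *: f + g).
Proof.
move=> cf cg x; apply: (@cvgD _ _ _ _ _ (a \*: f) g); last exact: cg.
by apply: cvgZl_tmp; exact: cf.
Qed.

Section continuous_functions.
Context {R : realType} {T : topologicalType} (X : set T).

Definition contpred : {pred X -> R} := mem [set f : X -> R | continuous f].

Lemma contpredP (f : X -> R) : f \in contpred <-> continuous f.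
Proof. by rewrite inE. Qed.

Lemma contpred_submod : submod_closed contpred.
Proof.
split; first by apply/contpredP => x; exact: cst_continuous.
move=> a f g /contpredP cf /contpredP cg; apply/contpredP.
exact: continuous_lincomb.
Qed.

HB.instance Definition _ :=
  GRing.isSubmodClosed.Build R (X -> R) contpred contpred_submod.

(* The functions have domain the subtype of X, carrying the subspace topology.
   The compactness proof is a phantom parameter: the supremum norm is a norm
   only because X is compact. *)
Definition C1 (cX : compact X) : Type := {f : X -> R | f \in contpred}.

Variable cX : compact X.

HB.instance Definition _ := SubChoice.on (C1 cX).
HB.instance Definition _ := [SubChoice_isSubLmodule of C1 cX by <:].

Definition C1_fun (f : C1 cX) : X -> R := val f.

Definition C1_norm (f : C1 cX) : R :=
  sup [set `|C1_fun f x| | x in [set: X]].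

Lemma C1_fun_continuous (f : C1 cX) : continuous (C1_fun f).
Proof. exact/contpredP/valP. Qed.

Lemma C1_has_ubound (f : C1 cX) :
  has_ubound [set `|C1_fun f x| | x in [set: X]].
Proof.
have /subspace_valL_continuousP cf := @C1_fun_continuous f.
have /compact_bounded[M [_ bM]] := continuous_compact cf cX.
exists (M + 1) => _ [x _ <-].
apply: (bM (M + 1)) => //=; first by rewrite ltrDl.
exists (set_val x); first exact: set_valP.
by rewrite /valL; have := congr1 (@^~ x) (valLK point (C1_fun f)).
Qed.

Lemma C1_norm_ge (f : C1 cX) x : `|C1_fun f x| <= C1_norm f.
Proof. by apply: (ub_le_sup (C1_has_ubound f)); exists x. Qed.

Lemma C1_norm_le (f : C1 cX) (M : R) : 0 <= M ->
  (forall x, `|C1_fun f x| <= M) -> C1_norm f <= M.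
Proof.
move=> M0 fM; rewrite /C1_norm.
have [->|/set0P ne] := eqVneq [set `|C1_fun f x| | x in [set: X]] set0.
  by rewrite sup0.
by apply: ge_sup => // _ [x _ <-].
Qed.

Lemma C1_norm_ge0 (f : C1 cX) : 0 <= C1_norm f.
Proof.
have [[x _]|] := pselect ([set: X] !=set0).
  exact: le_trans (C1_norm_ge f x).
by move=> /set0P/negP/negPn/eqP X0; rewrite /C1_norm X0 image_set0 sup0.
Qed.

Lemma C1_ler_normD (f g : C1 cX) : C1_norm (f + g) <= C1_norm f + C1_norm g.
Proof.
apply: C1_norm_le => [|x]; first by rewrite addr_ge0 ?C1_norm_ge0.
by rewrite (le_trans (ler_normD _ _))// lerD ?C1_norm_ge.
Qed.

Lemma C1_normrZ (a : R) (f : C1 cX) : C1_norm (a *: f) = `|a| * C1_norm f.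
Proof.
have nZ (b : R) g : C1_norm (b *: g) <= `|b| * C1_norm g.
  apply: C1_norm_le => [|x]; first by rewrite mulr_ge0 ?C1_norm_ge0.
  by rewrite /C1_fun /= normrM ler_wpM2l ?C1_norm_ge.
apply/eqP; rewrite eq_le nZ /=.
have [->|a0] := eqVneq a 0; first by rewrite normr0 mul0r C1_norm_ge0.
have := nZ a^-1 (a *: f).
by rewrite scalerA mulVf// scale1r normfV ler_pdivlMl ?normr_gt0.
Qed.

Lemma C1_normr0_eq0 (f : C1 cX) : C1_norm f = 0 -> f = 0.
Proof.
move=> f0; apply/val_inj/funext => x; apply/eqP.
by rewrite -normr_le0 -f0 C1_norm_ge.
Qed.

HB.instance Definition _ := @Lmodule_isNormed.Build R (C1 cX)
  C1_norm C1_ler_normD C1_normrZ C1_normr0_eq0.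

Lemma C1_complete (F : set_system (C1 cX)) :
  ProperFilter F -> cauchy F -> cvg F.
Proof.
move=> FF /cauchy_ballP Fc.
pose G : set_system (arrow_uniform_type X R) := C1_fun @ F.
have FG : ProperFilter G by exact: fmap_proper_filter.
have Gc : cauchy G.
  apply/cauchy_ballP => e e0; have [[P Q] /= [FP FQ] PQ] := Fc _ e0.
  exists (C1_fun @` P, C1_fun @` Q) => /=; first split.
  - by apply: (filterS _ FP) => f Pf; exists f.
  - by apply: (filterS _ FQ) => f Qf; exists f.
  move=> [_ _] /= [[f Pf <-] [g Qg <-]] x.
  by apply: le_lt_trans (PQ (f, g) (conj Pf Qg)); exact: (C1_norm_ge (f - g)).
have /cvg_ex[g Gg] : cvg G by exact: fun_complete.
have /contpredP gC : continuous (g : X -> R).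
  apply: (@uniform_limit_continuous _ _ G) => //.
    have : \forall h \near F, continuous (C1_fun h); last exact.
    by apply: nearW => h; exact: C1_fun_continuous.
  by move=> A; rewrite uniform_nbhsT; exact: Gg.
apply/cvg_ex; exists (exist _ g gC : C1 cX).
apply/cvgrPdist_le => e e0.
have : \forall h \near G, ball (g : arrow_uniform_type X R) e h.
  by apply: Gg; exact: nbhsx_ballx.
rewrite /G near_simpl; apply: filterS => h gh.
by apply: C1_norm_le => [|x]; [exact: ltW|exact/ltW/(gh x)].
Qed.

HB.instance Definition _ := Uniform_isComplete.Build (C1 cX) C1_complete.

End continuous_functions.
Arguments C1 R {T X} cX.
Coercion C1_fun : C1 >-> Funclass.

Notation borelType E := (g_sigma_algebraType (@open E)).

Section prevalence.
Context {R : realType} {E : completeNormedModType R}.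

(* K is closed, hence Borel: the measure is concentrated on a compact set. *)
Definition compactly_supported (mu : probability (borelType E) R) : Prop :=
  exists2 K : set E, compact K & mu (~` K) = 0%E.

Definition borel_shy (S : set E) : Prop :=
  measurable (S : set (borelType E)) /\
  exists2 mu : probability (borelType E) R, compactly_supported mu &
    forall x : E, mu [set s + x | s in S] = 0%E.

(* A Borel subset of a Borel shy set is Borel shy (for the same measure), so
   this agrees with borel_shy on Borel sets. *)
Definition shy (S : set E) : Prop :=
  exists2 B : set E, borel_shy B & S `<=` B.

Definition prevalent (S : set E) : Prop := shy (~` S).

End prevalence.

Section hausdorff.
Context {R : realType} {n : nat}.

(* The norm of 'rV[R]_n in the library is the sup norm. *)
Definition edist (x y : 'rV[R]_n) : R :=
  Num.sqrt (\sum_(i < n) (x 0 i - y 0 i) ^+ 2).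

(* -oo on the empty set *)
Definition ediam (U : set 'rV[R]_n) : \bar R :=
  ereal_sup [set (edist p.1 p.2)%:E | p in U `*` U].

(* |U|^s, with 0^0 = 1 for nonempty U and |set0|^s = 0, including for s = 0. *)
Definition diam_pow (s : R) (U : set 'rV[R]_n) : \bar R :=
  if U == set0 then 0%E else poweR (ediam U) s.

Definition hausdorff_premeasure (s delta : R) (F : set 'rV[R]_n) : \bar R :=
  ereal_inf [set (\sum_(0 <= i <oo) diam_pow s (U i))%E |
    U in [set U : nat -> set 'rV[R]_n |
      F `<=` \bigcup_i U i /\ forall i, (ediam (U i) <= delta%:E)%E]].

(* the supremum over delta > 0 is the limit as delta tends to 0 *)
Definition hausdorff_measure (s : R) (F : set 'rV[R]_n) : \bar R :=
  ereal_sup [set hausdorff_premeasure s delta F |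
    delta in [set delta : R | 0 < delta]].

Definition dimH (F : set 'rV[R]_n) : \bar R :=
  ereal_inf [set s%:E | s in [set s : R | 0 <= s /\ hausdorff_measure s F = 0%E]].

End hausdorff.

Definition graph {R : realType} {m : nat} {X : set 'rV[R]_m} (f : X -> R) :
    set 'rV[R]_(m + 1) :=
  [set row_mx (set_val x) (const_mx (f x)) | x in [set: X]].

(* Main.v *)
(* The upper bound dim G_f <= dim X + 1 is proved by cutting the cylinder over
   each piece of a cover of X into slabs.

   For the lower bound, the random function is
     F = \sum_j (e_j / n_j) / ((j+1) (j+2)) psi_j,
   where |psi_j| <= 1 and the e_j are the mixed radix digits, in radix n_j, of a
   uniform point of [0, 1]; its law has compact support. If psi_j separates p
   and q by c0 and p, q are 2^-k-close, then n_j >= 2^k for n_j large enough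
   (uniform continuity), and averaging over the j-th digit alone gives, for every
   z, P(|F p - F q + z| <= 2^-k) <= 5 (j+1) (j+2) 2^-k / c0. Therefore, for finitely
   supported weights on X spread well enough, the s-energies of their lifts to
   the graph of F - g have bounded means. By Markov's inequality they almost
   surely do not tend to infinity, and a graph along which they do not has
   dimension at least s.

   If dim X > 0, the psi_j are the functions cos (2^k x_i) and sin (2^k x_i),
   which separate points at all scales, the weights are discrete Frostman
   weights of exponent t < dim X, and s < t + 1. If dim X = 0 and X is
   uncountable, the psi_j are Urysohn functions of a binary scheme in a
   coordinate projection of X, so that all 0-1 sequences of length M are values
   of (psi_0, ..., psi_(M-1)); the weights are equidistributed on 2^M points
   realizing them, and s < 1. *)
From HB Require Import structures.
Require Import Defs.
From mathcomp Require Import all_boot all_order all_algebra.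
From mathcomp Require Import all_classical all_reals all_analysis.
From mathcomp Require Import measurable_realfun.
From mathcomp Require Import ring lra zify.
Import Order.TTheory GRing.Theory Num.Theory.
Import numFieldNormedType.Exports.

Local Open Scope classical_set_scope.
Local Open Scope ring_scope.

Set Implicit Arguments.
Unset Strict Implicit.
Unset Printing Implicit Defensive.

(* MathComp-Analysis has an unrelated edist. *)
Local Notation edist := Defs.edist.

(** * Weighted pair sums and discrete Frostman weights *)

(** The amplitudes have to be summable because the [psi_j] are bounded but not small, and their
    inverses enter the small-ball estimate. Inverses of polynomial growth do no harm, since the
    energy of the pairs first separated at level [j] otherwise decays geometrically. Digits take the
    place of independent uniform variables: one uniform number drives the whole series, and
    probabilities are bounded by averages over finitely many digit strings. Likewise, finitely
    supported weights at every scale take the place of a Frostman measure, so that no weak limit is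
    formed. The obstacle to a single argument is dimension 0: there are no Frostman weights of
    positive exponent, so the separating functions have to come from uncountability alone. *)

Section pair_sum.
Context {R : realFieldType} {T : Type}.

Definition unsep (sep : nat -> T -> T -> bool) (j : nat) (p q : T) : bool :=
  all (fun i => ~~ sep i p q) (iota 0 j).

(* The pairs (p, q) are sorted according to the first level j at which sep holds. *)
Lemma pair_sum_bound (s : seq T) (w : T -> R) (K : T -> T -> R)
    (sep : nat -> T -> T -> bool) (N : nat) (tau theta : nat -> R) :
  (forall p, 0 <= w p) -> (forall j, 0 <= tau j) ->
  (forall j p q, (j < N)%N -> unsep sep j p q -> sep j p q ->
     K p q <= tau j) ->
  (forall p q, unsep sep N p q -> K p q <= tau N) ->
  (forall j p, (j <= N)%N -> \sum_(q <- s | unsep sep j p q) w q <= theta j) ->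
  \sum_(p <- s) \sum_(q <- s) w p * w q * K p q <=
  (\sum_(p <- s) w p) * \sum_(j < N.+1) tau j * theta j.
Proof.
move=> w0 tau0 Ksep Kun wth.
rewrite mulr_suml; apply: ler_sum => p _.
have Kle q : K p q <= \sum_(j < N.+1) tau j * (unsep sep j p q)%:R.
  have [un|] := boolP (unsep sep N p q).
    rewrite big_ord_recr/= un mulr1; apply: (le_trans (Kun _ _ un)).
    by rewrite lerDr sumr_ge0// => i _; rewrite mulr_ge0// ler0n.
  rewrite {1}/unsep all_predC negbK => hs.
  have [j [jN sj uj]] : exists j, [/\ (j < N)%N, sep j p q & unsep sep j p q].
    have jN := hs; rewrite has_find size_iota in jN.
    exists (find (sep^~ p ^~ q) (iota 0 N)); split => //.
      by move: (nth_find 0%N hs); rewrite nth_iota.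
    rewrite /unsep all_predC; apply/hasPn => i.
    rewrite mem_iota add0n => /andP[_ ij].
    by move: (before_find 0%N ij); rewrite nth_iota ?(ltn_trans ij) //= => ->.
  have jN1 : (j < N.+1)%N by rewrite ltnS ltnW.
  rewrite (bigD1 (Ordinal jN1))//= uj mulr1.
  apply: (le_trans (Ksep _ _ _ jN uj sj)).
  by rewrite lerDl sumr_ge0// => i _; rewrite mulr_ge0// ler0n.
rewrite (_ : \sum_(q <- s) _ = w p * \sum_(q <- s) w q * K p q); last first.
  by rewrite mulr_sumr; apply: eq_bigr => q _; rewrite mulrA.
apply: ler_wpM2l => //.
apply: (@le_trans _ _ (\sum_(q <- s) \sum_(j < N.+1) tau j * (w q * (unsep sep j p q)%:R))).
  apply: ler_sum => q _; apply: (le_trans (ler_wpM2l (w0 q) (Kle q))).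
  by rewrite mulr_sumr; apply: ler_sum => j _; rewrite mulrCA.
rewrite exchange_big/=; apply: ler_sum => j _.
rewrite -mulr_sumr; apply: ler_wpM2l => //.
have jN : (j <= N)%N by rewrite -ltnS.
apply: le_trans (wth j p jN); rewrite big_mkcond [leRHS]big_mkcond/=.
apply: ler_sum => q _.
by case: unsep; rewrite ?mulr1 ?mulr0.
Qed.

End pair_sum.

Section frostman.
Context {R : realType} {T : Type} {I : eqType}.
Variables (idx : nat -> T -> I) (c : nat -> R) (rg : nat -> seq I).
Hypothesis c_gt0 : forall k, 0 < c k.
Hypothesis rg_uniq : forall k, uniq (rg k).
Hypothesis idx_rg : forall k x, idx k x \in rg k.
Hypothesis idx_refine : forall k x y, idx k.+1 x = idx k.+1 y -> idx k x = idx k y.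

(* D z lists cells covering the cell z of level k, of total capacity at most the
   weight of z. The weights are capped level by level from N down to 0: a cell
   that exceeds its capacity c k is scaled down to c k and covered by itself. *)
Definition frostman_at (pts : seq T) (N k : nat) :=
  exists (w : T -> R) (D : I -> seq (nat * I)),
  [/\ forall p, 0 <= w p,
      forall x, has (fun d => idx d.1 x == d.2) (D (idx k x)),
      forall z, \sum_(d <- D z) c d.1 <= \sum_(p <- pts | idx k p == z) w p &
      forall j z, (k <= j <= N)%N -> \sum_(p <- pts | idx j p == z) w p <= c j].

(** One representative per occupied cell of level [N], each of weight [c N]: every occupied cell
    then carries exactly its capacity, and an empty one needs no cover. *)
Lemma frostman_base (N : nat) : exists pts : seq T, frostman_at pts N N.
Proof.
pose g z : option T := match pselect (exists x, idx N x = z) with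
  | left e => Some (projT1 (cid e)) | right _ => None end.
have gK z x : g z = Some x -> idx N x = z.
  by rewrite /g; case: pselect => // e [<-]; exact: projT2 (cid e).
have gN z : isSome (g z) = `[< exists x, idx N x = z >].
  rewrite /g; case: pselect => e /=; last by case: asboolP.
  by case: asboolP.
pose pts := pmap g (rg N); exists pts.
have sum1 z : \sum_(p <- pts | idx N p == z) c N =
    if `[< exists x, idx N x = z >] then c N else 0.
  rewrite /pts big_mkcond/=.
  have -> : \sum_(p <- pmap g (rg N)) (if idx N p == z then c N else 0) =
    \sum_(y <- rg N) (if (y == z) && `[< exists x, idx N x = y >] then c N else 0).
    elim: (rg N) => [|y s IH]; first by rewrite !big_nil.
    rewrite /= [RHS]big_cons -IH -gN /oapp.
    case gy: (g y) => [x|] /=; last by rewrite andbF add0r.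
    by rewrite big_cons (gK _ _ gy) andbT.
  have [zr|zr] := boolP (z \in rg N).
    rewrite (bigD1_seq z)//= eqxx/= big1 ?addr0// => y /negPf ->.
    by [].
  rewrite big1_seq; last first.
    by move=> y /andP[_ yr]; case: eqP => // e; rewrite -e yr in zr.
  case: asboolP => // -[x xz]; by rewrite -xz idx_rg in zr.
exists (fun=> c N), (fun z => if `[< exists x, idx N x = z >] then [:: (N, z)] else [::]).
split => [p|x|z|j z].
- exact: ltW.
- by case: asboolP => [_|]; [rewrite /= eqxx|case; exists x].
- by rewrite sum1; case: ifP; rewrite ?big_seq1 ?big_nil.
- rewrite -eqn_leq => /eqP <-; rewrite sum1; case: ifP => // _; exact: ltW.
Qed.

Lemma frostman_down (pts : seq T) (N k : nat) : (k < N)%N ->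
  frostman_at pts N k.+1 -> frostman_at pts N k.
Proof.
move=> kN [w [D [w0 Dcov Dsum wle]]].
pose m z := \sum_(p <- pts | idx k p == z) w p.
pose phi z := if m z <= c k then 1 else c k / m z.
have phi0 z : 0 <= phi z.
  rewrite /phi; case: ifP => // _; rewrite divr_ge0 ?sumr_ge0 ?ltW//.
have phi1 z : phi z <= 1.
  rewrite /phi; case: ifPn => //; rewrite -ltNge => h.
  by rewrite ler_pdivrMr ?mul1r ?ltW// (lt_trans _ h).
have phim z : \sum_(p <- pts | idx k p == z) w p * phi (idx k p) = m z * phi z.
  by rewrite mulr_suml; apply: eq_bigr => p /eqP ->.
(* [y] is an occupied child of [z]. A cell within its capacity inherits the covers of its children;
   by refinement their points all lie in [z], so the bound on the sum of capacities is inherited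
   too. *)
pose ch z y := `[< exists x, idx k.+1 x = y /\ idx k x = z >].
exists (fun p => w p * phi (idx k p)),
  (fun z => if m z <= c k then flatten [seq D y | y <- rg k.+1 & ch z y]
            else [:: (k, z)]).
split => [p|x|z|j z].
- by rewrite mulr_ge0.
- case: ifPn => [_|_ /=]; last by rewrite eqxx.
  have /hasP[d dD hd] := Dcov x.
  apply/hasP; exists d => //; apply/flattenP; exists (D (idx k.+1 x)) => //.
  apply/mapP; exists (idx k.+1 x) => //; rewrite mem_filter idx_rg andbT.
  by apply/asboolP; exists x.
- rewrite phim; case: ifPn => [le|]; last first.
    rewrite -ltNge => lt; rewrite big_seq1 /= /phi (lt_geF lt).
    by rewrite mulrC divfK// gt_eqF// (lt_trans _ lt).
  rewrite /phi le mulr1 big_flatten/= big_map big_filter.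
  apply: (le_trans (ler_sum _ (fun y _ => Dsum y))).
  rewrite /m (exchange_big_dep xpredT)//= [leRHS]big_mkcond/=.
  apply: ler_sum => p _.
  case: eqP => [pz|npz].
    rewrite big_mkcond/= (bigD1_seq (idx k.+1 p))//= big1 ?addr0.
      by case: ifP.
    by move=> y /negPf; rewrite eq_sym => ->; rewrite andbF.
  rewrite big1_seq// => y /andP[/andP[/asboolP[x [xy xz]] /eqP py] _].
  by case: npz; rewrite -xz; apply: idx_refine; rewrite xy.
- move=> /andP[kj jN]; move: kj; rewrite leq_eqVlt => /orP[/eqP <-|kj].
    rewrite phim /phi; case: ifPn => [|]; first by rewrite mulr1.
    by rewrite -ltNge => lt; rewrite mulrC divfK// gt_eqF// (lt_trans _ lt).
  apply: le_trans (wle j z _); last by rewrite kj.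
  by apply: ler_sum => p _; rewrite ler_piMr.
Qed.

(** The cover [D] turns a positive lower bound on the capacities of all covers into a lower bound on
    the total mass that is independent of [N]. This is the finite form of Frostman's lemma. *)
Lemma frostman_weights (N : nat) :
  exists (pts : seq T) (w : T -> R) (D : seq (nat * I)),
  [/\ forall p, 0 <= w p,
      forall x, has (fun d => idx d.1 x == d.2) D,
      \sum_(d <- D) c d.1 <= \sum_(p <- pts) w p,
      \sum_(p <- pts) w p <= (size (rg 0))%:R * c 0 &
      forall j z, (j <= N)%N -> \sum_(p <- pts | idx j p == z) w p <= c j].
Proof.
have [pts base] := frostman_base N; exists pts.
have : forall i, (i <= N)%N -> frostman_at pts N (N - i).
  elim=> [|i IH] iN; first by rewrite subn0.
  apply: frostman_down; first by rewrite ltn_subrL (leq_trans _ iN).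
  by rewrite subnSK//; apply: IH; exact: ltnW.
move=> /(_ N (leqnn N)); rewrite subnn => -[w [D [w0 Dcov Dsum wle]]].
have sumE : \sum_(p <- pts) w p = \sum_(z <- rg 0) \sum_(p <- pts | idx 0 p == z) w p.
  rewrite (exchange_big_dep xpredT)//=; apply: eq_bigr => p _.
  rewrite big_mkcond/= (bigD1_seq (idx 0 p))//= eqxx big1 ?addr0//.
  by move=> y /negPf; rewrite eq_sym => ->.
exists w, (flatten [seq D z | z <- rg 0]); split => //.
- move=> x; have /hasP[d dD hd] := Dcov x.
  apply/hasP; exists d => //; apply/flattenP; exists (D (idx 0 x)) => //.
  by apply/mapP; exists (idx 0 x).
- by rewrite sumE big_flatten/= big_map; apply: ler_sum => z _; exact: Dsum.
- rewrite sumE; apply: (le_trans (ler_sum _ (fun z _ => wle 0 z isT))).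
  by rewrite big_const_seq count_predT iter_addr_0 mulr_natl.
Qed.

End frostman.

(** * Averages over mixed radix digits *)

Section mixed_radix.
Context {R : realType}.
Variables (n : nat -> nat) (c : nat -> R).
Hypothesis n_gt0 : forall j, (0 < n j)%N.

Fixpoint radix_prod (J : nat) : nat :=
  if J is J'.+1 then (radix_prod J' * n J')%N else 1%N.

(* z + \sum_(j < J) c j * (e_j / n j), where e_0, ..., e_(J-1) are the digits of
   i < radix_prod J in mixed radix n, e_(J-1) being the least significant one. *)
Fixpoint walk (z : R) (J i : nat) : R :=
  if J is J'.+1 then walk z J' (i %/ n J') + c J' * ((i %% n J')%:R / (n J')%:R)
  else z.

Lemma radix_prod_gt0 J : (0 < radix_prod J)%N.
Proof. by elim: J => //= J IH; rewrite muln_gt0 IH n_gt0. Qed.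

Lemma sum_ord_mul (a b : nat) (F : nat -> R) : (0 < b)%N ->
  \sum_(i < a * b) F i = \sum_(i < a) \sum_(e < b) F (i * b + e)%N.
Proof.
move=> b0; elim: a => [|a IH]; first by rewrite mul0n !big_ord0.
rewrite mulSn addnC big_ord_recr/= -IH big_split_ord/=; congr (_ + _).
Qed.

(* The averages over the digits commute, so averaging first over the digit j0
   transfers the bound to the average over all digits. *)
Lemma walk_average (z : R) (j0 J : nat) (h : R -> R) (b : R) : (j0 < J)%N ->
  (forall y, \sum_(e < n j0) h (y + c j0 * (e%:R / (n j0)%:R)) <= b * (n j0)%:R) ->
  \sum_(i < radix_prod J) h (walk z J i) <= b * (radix_prod J)%:R.
Proof.
elim: J h b => // J IH h b; rewrite ltnS leq_eqVlt => j0J hb.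
rewrite [radix_prod _]/=.
rewrite (sum_ord_mul (radix_prod J) (fun i => h (walk z J.+1 i)))//.
have walkE i (e : 'I_(n J)) : walk z J.+1 (i * n J + e) =
    walk z J i + c J * (e%:R / (n J)%:R).
  by rewrite /= divnMDl// modnMDl divn_small// addn0 modn_small.
under eq_bigr do under eq_bigr do rewrite walkE.
rewrite natrM; case/orP: j0J => [/eqP j0J|j0J].
  move: hb; rewrite j0J => hb.
  apply: (@le_trans _ _ (\sum_(i < radix_prod J) (b * (n J)%:R))).
    by apply: ler_sum => i _; exact: hb.
  by rewrite sumr_const card_ord -mulr_natl; rewrite le_eqVlt; apply/orP; left; apply/eqP; ring.
rewrite (_ : b * _ = (b * (n J)%:R) * (radix_prod J)%:R); last by ring.
(* The digit [J] is summed into [h], which leaves the digit [j0] to the induction hypothesis. *)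
apply: (IH (fun y => \sum_(e < n J) h (y + c J * (e%:R / (n J)%:R)))) => // y.
rewrite exchange_big/= (_ : _ * _ = \sum_(e < n J) (b * (n j0)%:R)); last first.
  by rewrite sumr_const card_ord -mulr_natr; ring.
apply: ler_sum => e _; apply: le_trans (hb (y + c J * (e%:R / (n J)%:R))).
by apply: ler_sum => i _; rewrite addrAC.
Qed.

(* The indicator of [-r, r] is dominated by the difference quotient
   (H (y + v) - H y) / v of a clamp H, and the difference quotients telescope. *)
Lemma digit_small_ball (r : R) (k : nat) (v : R) (y : R) : (0 < k)%N -> 0 < v -> 0 <= r ->
  \sum_(e < k) (`|y + v * (e%:R / k%:R)| <= r)%R%:R <=
  ((2 * r + v / k%:R) / v) * k%:R.
Proof.
move=> k0 v0 r0.
have kR : 0 < k%:R :> R by rewrite ltr0n.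
pose u := v / k%:R; have u0 : 0 < u by rewrite divr_gt0.
(* The upper clamp is [r + u], not [r], so that the step from [x] to [x + u] counts in full even for
   [x = r]. *)
pose H x : R := Num.min (Num.max x (- r)) (r + u).
have Hb x : - r <= H x <= r + u.
  apply/andP; split; last by rewrite /H ge_min lexx orbT.
  by rewrite /H le_min le_max lexx orbT /=; lra.
have Hmono x : H x <= H (x + u).
  rewrite /H le_min; apply/andP; split; last by rewrite ge_min lexx orbT.
  by rewrite ge_min ge_max !le_max lexx orbT/= andbT lerDl (ltW u0).
have Hd x : (`|x| <= r)%R%:R * u <= H (x + u) - H x.
  case: (boolP (`|x| <= r)) => [xr|]; last by rewrite mul0r subr_ge0.
  have /andP[x1 x2] : - r <= x <= r by rewrite -ler_norml.
  rewrite mul1r /H !max_l; [|lra|lra].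
  by rewrite !min_l; lra.
have step (e : nat) : v * (e.+1%:R / k%:R) = v * (e%:R / k%:R) + u.
  by rewrite -natr1 /u; field; rewrite gt_eqF.
rewrite -(ler_pM2r u0) mulr_suml.
rewrite (_ : _ * u = 2 * r + u); last by rewrite /u; field; rewrite !gt_eqF.
apply: (@le_trans _ _ (\sum_(0 <= e < k) (H (y + v * (e.+1%:R / k%:R)) - H (y + v * (e%:R / k%:R))))).
  rewrite big_mkord; apply: ler_sum => e _.
  by rewrite step addrA; exact: Hd.
rewrite (telescope_sumr (fun e => H (y + v * (e%:R / k%:R))))//.
have /andP[_ h1] := Hb (y + v * (k%:R / k%:R)).
have /andP[h2 _] := Hb (y + v * (0%:R / k%:R)).
by lra.
Qed.

Lemma walk_small_ball (z : R) (j0 J : nat) (r : R) : (j0 < J)%N -> 0 < c j0 -> 0 <= r ->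
  \sum_(i < radix_prod J) (`|walk z J i| <= r)%R%:R <=
  ((2 * r + c j0 / (n j0)%:R) / c j0) * (radix_prod J)%:R.
Proof.
move=> j0J c0 r0.
apply: (walk_average z (h := fun y => (`|y| <= r)%R%:R) j0J) => y.
exact: digit_small_ball.
Qed.

End mixed_radix.

Lemma expr_lt_eps {R : realType} (x e : R) : 0 <= x < 1 -> 0 < e ->
  exists N, forall n, (N <= n)%N -> x ^+ n < e.
Proof.
move=> /andP[x0 x1] e0.
have x1' : `|x| < 1 by rewrite ger0_norm.
have /cvgrPdist_lt/(_ e e0)[N _ h] := cvg_expr x1'.
exists N => n Nn; have := h n Nn.
by rewrite /= sub0r normrN ger0_norm// exprn_ge0.
Qed.

Lemma half_pow_lt {R : realType} (e : R) : 0 < e ->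
  exists N, forall n, (N <= n)%N -> 2^-1 ^+ n < e :> R.
Proof. by apply: expr_lt_eps; apply/andP; split; lra. Qed.

Lemma eseries_finite {R : realType} (f : nat -> \bar R) (n : nat) :
  (forall i, 0 <= f i)%E -> (forall i, (n <= i)%N -> f i = 0%E) ->
  (\sum_(0 <= i <oo) f i = \sum_(0 <= i < n) f i)%E.
Proof.
move=> f0 fn; rewrite (nneseries_split 0 n)// add0n [X in (_ + X)%E]eseries0 ?adde0//.
by move=> i ni _; exact: fn.
Qed.

(** * Hausdorff measures and graphs *)

Section hausdorff_facts.
Context {R : realType} {n : nat}.
Implicit Types (U V F : set 'rV[R]_n) (x y : 'rV[R]_n).

Lemma edist_coord x y i : `|x 0 i - y 0 i| <= edist x y.
Proof.
rewrite /edist -sqrtr_sqr ler_sqrt ?sumr_ge0//; last by move=> ? _; exact: sqr_ge0.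
by rewrite (bigD1 i)//= lerDl sumr_ge0// => ? _; exact: sqr_ge0.
Qed.

Lemma edist_le x y (e : R) : 0 <= e -> (forall i, `|x 0 i - y 0 i| <= e) ->
  edist x y <= n%:R * e.
Proof.
move=> e0 h; rewrite /edist -[leRHS]ger0_norm ?mulr_ge0//.
rewrite -sqrtr_sqr ler_sqrt ?sqr_ge0//.
apply: (@le_trans _ _ (\sum_(i < n) e ^+ 2)).
  apply: ler_sum => i _; rewrite -real_normK ?num_real//.
  by rewrite lerXn2r ?nnegrE.
rewrite sumr_const card_ord -[leLHS]mulr_natl exprMn; apply: ler_wpM2r; first exact: sqr_ge0.
by rewrite -natrX ler_nat; case: n => // k; rewrite leq_pmulr.
Qed.

Lemma edistxx x : edist x x = 0.
Proof.
by rewrite /edist big1 ?sqrtr0// => i _; rewrite subrr expr0n.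
Qed.

Lemma ediam_ub U x y : U x -> U y -> ((edist x y)%:E <= ediam U)%E.
Proof. by move=> Ux Uy; apply: ereal_sup_ubound; exists (x, y). Qed.

Lemma ediam_le U (e : \bar R) : (forall x y, U x -> U y -> (edist x y)%:E <= e)%E ->
  (ediam U <= e)%E.
Proof. by move=> h; apply: ge_ereal_sup => _ [[x y] [/= Ux Uy] <-]; exact: h. Qed.

Lemma ediam_ge0 U : U !=set0 -> (0 <= ediam U)%E.
Proof. by move=> [x Ux]; have := ediam_ub Ux Ux; rewrite edistxx. Qed.

Lemma diam_pow_ge0 s U : (0 <= diam_pow s U)%E.
Proof. by rewrite /diam_pow; case: ifP => // _; exact: poweR_ge0. Qed.

Lemma diam_pow0 s : diam_pow s (set0 : set 'rV[R]_n) = 0%E.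
Proof. by rewrite /diam_pow eqxx. Qed.

Lemma diam_pow_le s U (e : R) : 0 <= s -> 0 <= e -> (ediam U <= e%:E)%E ->
  (diam_pow s U <= (e `^ s)%:E)%E.
Proof.
move=> s0 e0 Ue; rewrite /diam_pow; case: ifPn => [_|/set0P U0].
  by rewrite lee_fin powR_ge0.
rewrite -poweR_EFin; apply: gt0_ler_poweR => //.
- by rewrite in_itv/= ediam_ge0// leey.
- by rewrite in_itv/= lee_fin e0 leey.
Qed.

(** Rounding a diameter up to a dyadic scale costs a factor of at most 2, hence 2^s after taking
    powers. The term [e] serves sets of diameter 0, to which no dyadic scale is comparable. *)
Lemma ediam_dyadic s U (e : R) (k0 : nat) : U !=set0 -> 0 <= s -> 0 < e ->
  (ediam U < (2^-1 ^+ k0)%:E)%E ->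
  exists k, [/\ (k0 <= k)%N, (ediam U < (2^-1 ^+ k)%:E)%E &
    (((2^-1 ^+ k) `^ s)%:E <= (2 `^ s)%:E * diam_pow s U + e%:E)%E].
Proof.
move=> U0 s0 e0 Uk0.
have := ediam_ge0 U0; rewrite /diam_pow ifF; last exact/negbTE/set0P.
case: (ediam U) Uk0 => [d| |]//; rewrite lte_fin lee_fin => dk0 d0.
rewrite poweR_EFin -EFinM -EFinD.
move: d0; rewrite le_eqVlt => /orP[/eqP d0|d0].
  rewrite -d0; have [s00|s00] := eqVneq s 0.
    exists k0; split => //; first by rewrite lte_fin exprn_gt0.
    by rewrite s00 !powRr0 mul1r lee_fin lerDl ltW.
  have s1 : 0 < s by rewrite lt_neqAle eq_sym s00.
  have e1 : 0 < e `^ s^-1 by rewrite powR_gt0.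
  have [N hN] := half_pow_lt e1.
  exists (maxn k0 N); split; first exact: leq_maxl.
    by rewrite lte_fin exprn_gt0.
  rewrite powR0// mulr0 add0r lee_fin.
  rewrite [leRHS](_ : e = (e `^ s^-1) `^ s); last by rewrite -powRrM mulVf// powRr1 ?ltW.
  by apply: ge0_ler_powR; rewrite ?nnegrE ?ltW// ?exprn_gt0// hN// leq_maxr.
have [N hN] := half_pow_lt d0.
have ex : exists k, (k0 <= k)%N && (2^-1 ^+ k.+1 <= d).
  by exists (maxn k0 N); rewrite leq_maxl/= ltW// hN// ltnW// ltnS leq_maxr.
have [k /andP[k0k kd] kmin] := ex_minnP ex.
exists k; split => //.
  rewrite lte_fin; move: k0k; rewrite leq_eqVlt => /orP[/eqP <-//|k0k].
  rewrite ltNge; apply/negP => dk.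
  case: k k0k kd kmin dk => // k k0k _ kmin dk.
  by have := kmin k; rewrite -ltnS k0k dk /= => /(_ isT); rewrite ltnn.
rewrite lee_fin (@le_trans _ _ (2 `^ s * d `^ s))//; last by rewrite lerDl ltW.
rewrite -powRM//; last exact: ltW.
have d0' := ltW d0.
apply: ge0_ler_powR; rewrite ?nnegrE ?exprn_ge0 ?mulr_ge0//.
by move: kd; rewrite exprS; move: (2^-1 ^+ k) => x; lra.
Qed.

Lemma premeasure_ge0 s d F : (0 <= hausdorff_premeasure s d F)%E.
Proof.
apply: le_ereal_inf_tmp => _ [U _ <-].
by apply: nneseries_ge0 => i _ _; exact: diam_pow_ge0.
Qed.

Lemma premeasure_le_measure s d F : 0 < d ->
  (hausdorff_premeasure s d F <= hausdorff_measure s F)%E.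
Proof. by move=> d0; apply: ereal_sup_ubound; exists d. Qed.

Lemma hausdorff_measure_eq0 s F :
  (forall d : R, 0 < d -> (hausdorff_premeasure s d F <= 0)%E) ->
  hausdorff_measure s F = 0%E.
Proof.
move=> h; apply/eqP; rewrite eq_le; apply/andP; split.
  by apply: ge_ereal_sup => _ [d /= d0 <-]; exact: h.
by apply: le_trans (premeasure_le_measure s F ltr01); exact: premeasure_ge0.
Qed.

Lemma dimH_ge0 F : (0 <= dimH F)%E.
Proof. by apply: le_ereal_inf_tmp => _ [s [s0 _] <-]. Qed.

Lemma lt_dimH s F : 0 <= s -> (s%:E < dimH F)%E -> hausdorff_measure s F <> 0%E.
Proof.
move=> s0 + H; rewrite ltNge => /negP; apply.
by apply: ereal_inf_lbound; exists s.
Qed.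

(** A cover that contains a set of diameter above [d] already has a sum of at least the [s]-th power
    of [d], so a positive premeasure at scale [d] bounds the sums of all covers from below, whatever
    their diameters. *)
Lemma hausdorff_content s F : 0 < s -> hausdorff_measure s F <> 0%E ->
  exists2 c : R, 0 < c & forall U : nat -> set 'rV[R]_n,
    F `<=` \bigcup_i U i -> (c%:E <= \sum_(0 <= i <oo) diam_pow s (U i))%E.
Proof.
move=> s0 HF.
have [d d0 pd] : exists2 d : R, 0 < d & (0 < hausdorff_premeasure s d F)%E.
  apply: contrapT => h; apply: HF; apply: hausdorff_measure_eq0 => d d0.
  by rewrite leNgt; apply/negP => pd; apply: h; exists d.
have [c c0 cp] : exists2 c : R, 0 < c & (c%:E <= hausdorff_premeasure s d F)%E.
  case: (hausdorff_premeasure s d F) pd => [r| |]//; last by exists 1; rewrite ?leey.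
  by rewrite lte_fin => r0; exists r.
exists (Num.min c (d `^ s)); first by rewrite lt_min c0 powR_gt0.
move=> U FU.
have [h|] := pselect (forall i, (ediam (U i) <= d%:E)%E).
  apply: (@le_trans _ _ c%:E); first by rewrite lee_fin ge_min lexx.
  by apply: (le_trans cp); apply: ereal_inf_lbound; exists U.
move=> /existsNP[i /negP]; rewrite -ltNge => di.
apply: (@le_trans _ _ (diam_pow s (U i))).
  apply: (@le_trans _ _ (d `^ s)%:E); first by rewrite lee_fin ge_min lexx orbT.
  rewrite /diam_pow ifF; last first.
    apply/negbTE/eqP => U0; move: di; rewrite U0 /ediam set0X image_set0 ereal_sup0.
    by rewrite ltNge leNye.
  rewrite -poweR_EFin; apply: gt0_ler_poweR; rewrite ?in_itv/= ?leey ?andbT ?(ltW s0)//.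
  - by rewrite lee_fin ltW.
  - by rewrite (le_trans _ (ltW di))// lee_fin ltW.
  - exact: ltW.
rewrite (nneseriesD1 (n := i))//; last by move=> k _; exact: diam_pow_ge0.
by rewrite leeDl// nneseries_ge0// => k _ _; exact: diam_pow_ge0.
Qed.

Lemma premeasure_double s d F (G : nat -> nat -> set 'rV[R]_n) :
  F `<=` \bigcup_i \bigcup_j G i j -> (forall i j, ediam (G i j) <= d%:E)%E ->
  (hausdorff_premeasure s d F <=
   \sum_(0 <= i <oo) \sum_(0 <= j <oo) diam_pow s (G i j))%E.
Proof.
move=> FG Gd.
have g0 i j : (0 <= diam_pow s (G i j))%E by exact: diam_pow_ge0.
have /card_esym/ppcard_eqP[f] := card_nat2.
apply: ge_ereal_inf.
exists (\sum_(0 <= k <oo) diam_pow s (G (f k).1 (f k).2))%E.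
  exists (fun k => G (f k).1 (f k).2) => //; split => //.
  move=> x /FG[i _ [j _ Gx]]; exists (f^-1%FUN (i, j)) => //=.
  by rewrite invK ?inE.
rewrite nneseries_esumT//.
under eq_eseriesr => i _ do rewrite nneseries_esumT//.
rewrite nneseries_esumT; last by move=> i; apply: esum_ge0 => j _.
rewrite (@esum_esum _ _ _ setT (fun=> setT) (fun i j => diam_pow s (G i j)))//.
rewrite (@reindex_esum _ _ _ setT _ f (fun k => diam_pow s (G k.1 k.2)))//.
have -> : [set: nat] `*`` (fun=> [set: nat]) = [set: nat * nat].
  by apply/seteqP; split.
exact: bij.
Qed.

End hausdorff_facts.

Section graph_dimension.
Context {R : realType} {m : nat} {X : set 'rV[R]_m}.
Implicit Types f : X -> R.

Definition gpt (f : X -> R) (x : X) : 'rV[R]_(m + 1) :=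
  row_mx (set_val x) (const_mx (f x)).

Lemma edist_gpt_le f (x y : X) :
  edist (gpt f x) (gpt f y) <= edist (set_val x) (set_val y) + `|f x - f y|.
Proof.
rewrite /edist big_split_ord/= big_ord1.
under eq_bigr do rewrite !row_mxEl.
rewrite !row_mxEr !mxE.
set S := \sum_(i < m) _; have S0 : 0 <= S by rewrite sumr_ge0// => i _; exact: sqr_ge0.
rewrite -[leRHS]ger0_norm ?addr_ge0 ?sqrtr_ge0// -sqrtr_sqr ler_sqrt ?sqr_ge0//.
rewrite [leRHS]sqrrD sqr_sqrtr// real_normK ?num_real// addrAC lerDl.
by rewrite mulrn_wge0 ?mulr_ge0 ?sqrtr_ge0.
Qed.

(** A cover by points has sum 0 for every [s > 0], but not for [s = 0], where each point counts 1;
    the dimension is therefore bounded by arbitrarily small positive [s]. *)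
Lemma dimH_graph_countable f : countable X -> dimH (graph f) = 0%E.
Proof.
move=> cX; apply/eqP; rewrite eq_le dimH_ge0 andbT.
apply/lee_addgt0Pr => s s0; rewrite add0e.
apply: ereal_inf_lbound; exists s => //; split; first exact: ltW.
have /pfcard_geP[X0|[g]] := cX.
  apply: hausdorff_measure_eq0 => d d0.
  apply: ereal_inf_lbound; exists (fun=> set0).
    split => [t [x _ _]|_]; last first.
      by rewrite /ediam set0X image_set0 ereal_sup0 leNye.
    by have : (set0 : set _) (set_val x) by rewrite -X0; exact: set_valP.
  by rewrite eseries0// => i _ _; rewrite diam_pow0.
pose U i := [set gpt f x | x in [set x : X | g i = set_val x]].
have Ud (i : nat) : (ediam (U i) <= 0)%E.
  apply: ediam_le => _ _ [x /= gx <-] [y /= gy <-].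
  have -> : x = y by apply: val_inj; rewrite -[LHS]gx -[RHS]gy.
  by rewrite edistxx.
apply: hausdorff_measure_eq0 => d d0.
apply: ereal_inf_lbound; exists U.
  split => [_ [x _ <-]|i]; last by rewrite (le_trans (Ud i))// lee_fin ltW.
  have [i _ gi] := @surj _ _ _ _ g _ (set_valP x).
  by exists i => //; exists x.
rewrite eseries0// => i _ _; apply/eqP; rewrite eq_le diam_pow_ge0 andbT.
have := diam_pow_le (ltW s0) (lexx 0) (Ud i).
by rewrite powR0 ?gt_eqF.
Qed.

(** The extra 1 in [2 * B + 1] makes room for the end point [y = B%:R], whose slab starts there. *)
Lemma slab_count (B k : nat) (y : R) : `|y| <= B%:R ->
  exists2 j, (j < (2 * B + 1) * 2 ^ k)%N &
    - B%:R + j%:R * 2^-1 ^+ k <= y <= - B%:R + j.+1%:R * 2^-1 ^+ k.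
Proof.
rewrite ler_norml => /andP[y1 y2].
have h0 : 0 < 2^-1 ^+ k :> R by rewrite exprn_gt0.
have hK : 2^-1 ^+ k * 2 ^+ k = 1 :> R by rewrite -exprMn mulVf ?expr1n.
have z0 : 0 <= (y + B%:R) * 2 ^+ k by rewrite mulr_ge0 ?exprn_ge0//; lra.
exists (Num.truncn ((y + B%:R) * 2 ^+ k)).
  rewrite truncn_lt_nat//.
  rewrite natrM natrX ltr_pM2r ?exprn_gt0// natrD natrM; lra.
have /andP[] := truncn_itv z0; set j := Num.truncn _ => j1 j2.
have e : y + B%:R = ((y + B%:R) * 2 ^+ k) * 2^-1 ^+ k by rewrite -mulrA [_ * 2^-1 ^+ k]mulrC hK mulr1.
apply/andP; split.
  rewrite -lerBrDl opprK e ler_pM2r//.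
rewrite -lerBlDl opprK e ler_pM2r//; exact: ltW.
Qed.

(** A piece of diameter below 2^-k contributes about 2^k slabs of diameter at most 2 * 2^-k; in
    exponent [s + 1] their number cancels one power of the diameter. *)
Lemma dimH_graph_le f : (exists B, forall x, `|f x| <= B) ->
  (dimH (graph f) <= dimH X + 1)%E.
Proof.
move=> [B0 fB0].
have [B fB] : exists B : nat, forall x, `|f x| <= B%:R.
  exists (Num.truncn `|B0|).+1 => x; apply: (le_trans (fB0 x)).
  by apply: (le_trans (ler_norm _)); exact/ltW/truncnS_gt.
rewrite -leeBlDr//; apply: le_ereal_inf_tmp => _ [s [s0 Xs] <-].
rewrite leeBlDr// -EFinD; apply: ereal_inf_lbound.
exists (s + 1) => //; split; first by rewrite addr_ge0.
apply: hausdorff_measure_eq0 => d d0.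
(* [C] collects the number of slabs per 2^k and the factor 2 in their diameters; [C'] adds the cost
   of the dyadic rounding and of its errors, which sum to at most [e]. *)
pose C := (2 * B + 1)%:R * 2 `^ (s + 1) : R.
have C0 : 0 < C by rewrite mulr_gt0 ?powR_gt0// ltr0n addn1.
pose C' := C * (2 `^ s + 1).
have C'0 : 0 < C' by rewrite mulr_gt0// ltr_wpDr ?powR_ge0.
apply/lee_addgt0Pr => e' e'0; rewrite add0e.
pose e := e' / C'; have e0 : 0 < e by rewrite divr_gt0.
have [k0 hk0] : exists N, forall n, (N <= n)%N -> 2^-1 ^+ n < d / 2 :> R.
  by apply: half_pow_lt; rewrite divr_gt0.
have [_ [U [XU Ud] <-] Ue] : exists2 x, [set (\sum_(0 <= i <oo) diam_pow s (U i))%E |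
    U in [set U : nat -> set 'rV[R]_m |
      X `<=` \bigcup_i U i /\ forall i, (ediam (U i) <= (2^-1 ^+ k0.+1)%:E)%E]] x & (x < e%:E)%E.
  apply: ereal_inf_lt.
  have : (hausdorff_premeasure s (2^-1 ^+ k0.+1) X <= 0)%E.
    by rewrite -Xs; apply: premeasure_le_measure; rewrite exprn_gt0.
  by move=> /le_lt_trans; apply; rewrite lte_fin.
have /choice[k hk] : forall i, exists k, U i !=set0 ->
    [/\ (k0 <= k)%N, (ediam (U i) < (2^-1 ^+ k)%:E)%E &
    (((2^-1 ^+ k) `^ s)%:E <= (2 `^ s)%:E * diam_pow s (U i) + (e / (2 ^ i.+1)%:R)%:E)%E].
  move=> i; have [U0|U0] := pselect (U i !=set0); last by exists 0%N.
  have ei : 0 < e / (2 ^ i.+1)%:R by rewrite divr_gt0// ltr0n expn_gt0.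
  have Uk0 : (ediam (U i) < (2^-1 ^+ k0)%:E)%E.
    apply: (le_lt_trans (Ud i)); rewrite lte_fin exprS.
    have : 0 < 2^-1 ^+ k0 :> R by rewrite exprn_gt0.
    by move: (2^-1 ^+ k0) => x; lra.
  by have [k hk] := ediam_dyadic U0 s0 ei Uk0; exists k.
(* An empty piece gets no slabs, since its [k i] is a meaningless default. *)
pose N i := if `[< U i !=set0 >] then ((2 * B + 1) * 2 ^ k i)%N else 0%N.
pose G i j := if (j < N i)%N then [set gpt f x | x in [set x : X | U i (set_val x) /\
   - B%:R + j%:R * 2^-1 ^+ k i <= f x <= - B%:R + j.+1%:R * 2^-1 ^+ k i]] else set0.
have Gd i j : (ediam (G i j) <= (2 * 2^-1 ^+ k i)%:E)%E.
  rewrite /G; case: ifP => jN; last by rewrite /ediam set0X image_set0 ereal_sup0 leNye.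
  apply: ediam_le => _ _ [x [Ux fx] <-] [y [Uy fy] <-].
  have U0 : U i !=set0 by eexists; exact: Ux.
  have [_ Uik _] := hk i U0.
  rewrite lee_fin (le_trans (edist_gpt_le _ _ _))//.
  have := le_lt_trans (ediam_ub Ux Uy) Uik; rewrite lte_fin => h1.
  have h2 : `|f x - f y| <= 2^-1 ^+ k i.
    have e1 : j.+1%:R = j%:R + 1 :> R by rewrite natr1.
    rewrite e1 mulrDl mul1r in fx fy.
    by rewrite ler_norml; move: fx fy => /andP[? ?] /andP[? ?]; apply/andP; split; lra.
  by move: h1 h2; move: (2^-1 ^+ k i) (edist _ _) => a b; lra.
have Gd' i j : (ediam (G i j) <= d%:E)%E.
  have [U0|nU0] := pselect (U i !=set0); last first.
    rewrite /G /N asboolF// ltn0 /ediam set0X image_set0 ereal_sup0 leNye//.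
  apply: (le_trans (Gd i j)); rewrite lee_fin.
  by have [k0k _ _] := hk i U0; have := hk0 _ k0k; move: (2^-1 ^+ k i) => a; lra.
have cov : graph f `<=` \bigcup_i \bigcup_j G i j.
  move=> _ [x _ <-]; have [i _ Ui] := XU _ (set_valP x).
  have U0 : U i !=set0 by eexists; exact: Ui.
  have [j jN fj] := slab_count (k i) (fB x).
  exists i => //; exists j => //; rewrite /G /N asboolT// jN.
  by exists x.
apply: (le_trans (premeasure_double (s + 1) cov Gd')).
have pos i : (0 <= (2 `^ s)%:E * diam_pow s (U i))%E.
  by apply: mule_ge0; [rewrite lee_fin powR_ge0|exact: diam_pow_ge0].
have rhs0 i : (0 <= (2 `^ s)%:E * diam_pow s (U i) + (e / (2 ^ i.+1)%:R)%:E)%E.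
  by apply: adde_ge0 => //; rewrite lee_fin divr_ge0//; exact: ltW.
have sumG i : (\sum_(0 <= j <oo) diam_pow (s + 1) (G i j) <=
    C%:E * ((2 `^ s)%:E * diam_pow s (U i) + (e / (2 ^ i.+1)%:R)%:E))%E.
  rewrite (@eseries_finite _ _ (N i)); last first.
  - by move=> j; rewrite leqNgt /G => /negbTE ->; rewrite diam_pow0.
  - by move=> j; exact: diam_pow_ge0.
  have [U0|nU0] := pselect (U i !=set0); last first.
    by rewrite /N asboolF// big_geq//; apply: mule_ge0 => //; rewrite lee_fin ltW.
  have [_ _ hke] := hk i U0.
  apply: le_trans (lee_wpmul2l _ hke); last by rewrite lee_fin ltW.
  have h0 : 0 < 2^-1 ^+ k i :> R by rewrite exprn_gt0.
  apply: (@le_trans _ _ (\sum_(0 <= j < N i) ((2 * 2^-1 ^+ k i) `^ (s + 1))%:E)%E).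
    apply: lee_sum => j _; apply: diam_pow_le (Gd i j); first by rewrite addr_ge0.
    by rewrite mulr_ge0 ?ltW.
  rewrite sumEFin lee_fin sumr_const_nat subn0 /N asboolT//.
  rewrite powRM ?(ltW h0)// (powRD (x := 2^-1 ^+ k i)); last first.
    by apply/implyP => _; rewrite gt_eqF.
  rewrite powRr1 ?(ltW h0)// -[leLHS]mulr_natl natrM natrX /C.
  have hK : 2^-1 ^+ k i * 2 ^+ k i = 1 :> R by rewrite -exprMn mulVf ?expr1n.
  set a := 2^-1 ^+ k i in hK *; set b := 2 ^+ k i in hK *.
  rewrite [leLHS](_ : _ = (2 * B + 1)%:R * 2 `^ (s + 1) * a `^ s * (a * b)); last by ring.
  by rewrite hK mulr1.
apply: (le_trans (lee_nneseries _ (fun i _ => sumG i))).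
  by move=> *; apply: nneseries_ge0 => *; exact: diam_pow_ge0.
rewrite nneseriesZl; last by move=> *; exact: rhs0.
apply: (@le_trans _ _ (C%:E * ((2 `^ s)%:E * e%:E + e%:E))%E); last first.
  change ((C * (2 `^ s * e + e))%:E <= e'%:E)%E; rewrite lee_fin /e.
  rewrite le_eqVlt; apply/orP; left; apply/eqP; rewrite /C'; field.
  by rewrite !gt_eqF// ltr_wpDr ?powR_ge0.
apply: lee_wpmul2l; first by rewrite lee_fin ltW.
apply: (le_trans (epsilon_trick _ _ _)) => //; first exact: ltW.
rewrite nneseriesZl; last by move=> *; exact: diam_pow_ge0.
by rewrite leeD2r// lee_wpmul2l ?lee_fin ?powR_ge0// ltW.
Qed.

End graph_dimension.

(** * Energies *)

Section energy_cover.
Context {R : realType} {T : eqType}.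
Variables (s : R) (M : nat) (pts : seq T) (w : T -> R).
Variable near_at : nat -> T -> T -> bool.

(* A discrete s-energy of the weights w: for s > 0 the inner sum is comparable
   to the power -s of the distance, truncated at scale 2^-M. *)
Definition energy : R := \sum_(p <- pts) \sum_(q <- pts) w p * w q *
  \sum_(k < M) ((2^-1 ^+ k) `^ s)^-1 * (near_at k p q)%:R.

Hypothesis w_ge0 : forall p, 0 <= w p.

(** The capacity argument: the pairs inside piece [i] force an energy of at least its squared mass
    over [x i], and Cauchy-Schwarz bounds the squared total mass by the energy times the cost of the
    cover. Pieces without points are left out of the sum because their cost is not controlled in the
    application. *)
Lemma energy_cover (c K : R) (N : nat) (A : nat -> T -> bool) (k : nat -> nat) :
  0 < c -> 0 < K -> c <= \sum_(p <- pts) w p -> energy <= K ->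
  (forall p, exists2 i, (i < N)%N & A i p) ->
  (forall i p q, (i < N)%N -> A i p -> A i q -> near_at (k i) p q) ->
  (forall i, (i < N)%N -> (k i < M)%N) ->
  c ^+ 2 / K <= \sum_(i < N | has (A i) pts) (2^-1 ^+ k i) `^ s.
Proof.
move=> c0 K0 cw EK Acov Anear kM.
pose x i : R := (2^-1 ^+ k i) `^ s.
have x0 i : 0 < x i by rewrite powR_gt0// exprn_gt0.
have hA p : has (A^~ p) (iota 0 N).
  have [i iN Ai] := Acov p; apply/hasP; exists i => //.
  by rewrite mem_iota.
(* Each point is charged to the first piece that contains it, which makes the pieces disjoint. *)
pose first p := find (A^~ p) (iota 0 N).
have firstN p : (first p < N)%N by have := hA p; rewrite has_find size_iota.
have firstA p : A (first p) p.
  by have := nth_find 0%N (hA p); rewrite nth_iota ?firstN.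
pose mass i := \sum_(p <- pts | first p == i) w p.
have massE : \sum_(p <- pts) w p = \sum_(i < N) mass i.
  rewrite /mass (exchange_big_dep xpredT)//=; apply: eq_bigr => p _.
  rewrite (bigD1 (Ordinal (firstN p)))//= big1 ?addr0// => i /andP[/eqP e ne].
  by case/eqP: ne; apply: val_inj.
have mass0 i : ~~ has (A i) pts -> mass i = 0.
  move=> hi; rewrite /mass big_seq_cond big1// => p /andP[pp /eqP e].
  by case/hasP: hi; exists p => //; rewrite -e.
have massK : \sum_(i < N) mass i ^+ 2 / x i <= K.
  apply: le_trans EK.
  rewrite (_ : \sum_(i < N) _ = \sum_(p <- pts) \sum_(q <- pts) w p * w q *
    \sum_(i < N) (x i)^-1 * ((first p == i) && (first q == i))%:R).
    apply: ler_sum => p _; apply: ler_sum => q _.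
    apply: ler_wpM2l; first by rewrite mulr_ge0.
    rewrite (bigD1 (Ordinal (firstN p)))//= eqxx big1 ?addr0; last first.
      move=> i ne; case: eqP => [e|]; last by rewrite mulr0.
      by case/eqP: ne; apply: val_inj.
    have kp : (k (first p) < M)%N by apply: kM.
    rewrite (bigD1 (Ordinal kp))//=.
    rewrite ler_wpDr//.
      by rewrite sumr_ge0// => i _; rewrite mulr_ge0// invr_ge0 powR_ge0.
    apply: ler_wpM2l; first by rewrite invr_ge0 powR_ge0.
    case: eqP => [e|_]; last by rewrite ler0n.
    by rewrite Anear// -{1}e.
  under [RHS]eq_bigr do under eq_bigr do rewrite mulr_sumr.
  under [RHS]eq_bigr do rewrite exchange_big/=.
  rewrite exchange_big/=; apply: eq_bigr => i _.
  rewrite expr2 /mass [\sum_(p <- pts | _) _]big_mkcond/= !mulr_suml.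
  apply: eq_bigr => p _; rewrite mulr_sumr mulr_suml; apply: eq_bigr => q _.
  by case: eqP => _; case: eqP => _ /=; rewrite ?(mul0r, mulr0, mulr1, mul1r)// mulrA.
(* AM-GM: 2 mass <= l x + mass^2 / (l x). *)
pose l := K / c; have l0 : 0 < l by rewrite divr_gt0.
have amgm i : mass i <= (l * x i + (mass i ^+ 2 / x i) / l) / 2.
  have : 0 <= (l * x i - mass i) ^+ 2 / (l * x i) by rewrite divr_ge0 ?sqr_ge0// mulr_ge0 ?ltW.
  rewrite (_ : _ / _ = l * x i - 2 * mass i + mass i ^+ 2 / x i / l); last first.
    by field; rewrite !gt_eqF.
  by lra.
have : c <= (l * \sum_(i < N | has (A i) pts) x i + K / l) / 2.
  apply: (le_trans cw); rewrite massE.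
  apply: (@le_trans _ _ (\sum_(i < N) ((l * (if has (A i) pts then x i else 0) + (mass i ^+ 2 / x i) / l) / 2))).
    apply: ler_sum => i _; case: ifPn => [_|/mass0 ->]; first exact: amgm.
    by rewrite mulr0 expr0n !mul0r add0r mul0r.
  rewrite -mulr_suml ler_pM2r ?invr_gt0// big_split/= -mulr_sumr -big_mkcond/=.
  by rewrite lerD2l -mulr_suml ler_pM2r ?invr_gt0.
(* For [l = K / c] the last term is [c], half of which is absorbed on the left. *)
rewrite (_ : K / l = c); last by rewrite /l; field; rewrite !gt_eqF.
move=> h; rewrite ler_pdivrMr// -/(x _).
have : c <= l * \sum_(i < N | has (A i) pts) x i by lra.
by rewrite /l mulrAC ler_pdivlMr// -expr2 [K * _]mulrC.
Qed.

End energy_cover.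

Section energy_dimension.
Context {R : realType} {m : nat} {X : set 'rV[R]_m}.
Implicit Types f : X -> R.

Definition close (e : R) (p q : 'rV[R]_m) : bool :=
  [forall i, `|p 0 i - q 0 i| <= e].

Definition graph_near f (k : nat) (p q : X) : bool :=
  close (2^-1 ^+ k) (set_val p) (set_val q) && (`|f p - f q| <= 2^-1 ^+ k).

Lemma compact_set_type : compact X -> compact [set: X].
Proof.
move=> cX F FF _.
have FX : (set_val @ F) X.
  by apply: (@filterS _ F _ [set: X]) => [x _|]; [exact: set_valP|exact: filterT].
have [y [Xy cy]] := cX _ _ FX.
exists (SigSub (mem_set Xy) : X); split => // A B FA.
rewrite nbhsE => -[V [[W oW WV] Vy] VB].
have Wy : nbhs y W by apply: open_nbhs_nbhs; split => //; have := Vy; rewrite -WV.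
have FA' : (set_val @ F) (set_val @` A).
  by apply: (@filterS _ F _ A) => // a Aa; exists a.
have [_ [[a Aa <-] Wa]] := cy _ _ FA' Wy.
by exists a; split => //; apply: VB; rewrite -WV.
Qed.

Lemma gpt_continuous f l : continuous f -> continuous (fun x => gpt f x 0 l).
Proof.
move=> cf; case: (split_ordP l) => j ->.
  have -> : (fun x : X => gpt f x 0 (lshift 1 j)) =
      (fun M : 'rV[R]_m => M 0 j) \o set_val.
    by apply/funext => x; rewrite /gpt row_mxEl.
  move=> x; apply: continuous_comp; last exact: coord_continuous.
  exact: initial_continuous.
have -> : (fun x : X => gpt f x 0 (rshift m j)) = f.
  by apply/funext => x; rewrite /gpt row_mxEr mxE.
exact: cf.
Qed.

(** Compactness reduces a cover of the graph to finitely many pieces, whose scales lie below some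
    [M0]; hence it is enough that the energy is bounded for arbitrarily large [M]. *)
Lemma energy_dimH f (s c K : R) (pts : nat -> seq X) (w : nat -> X -> R) :
  compact X -> continuous f -> 0 <= s -> 0 < c -> 0 < K ->
  (forall M p, 0 <= w M p) -> (forall M, c <= \sum_(p <- pts M) w M p) ->
  (forall M0, exists2 M, (M0 <= M)%N &
     energy s M (pts M) (w M) (graph_near f) <= K) ->
  (s%:E <= dimH (graph f))%E.
Proof.
move=> cX cf s0 c0 K0 w0 cw EK.
apply: le_ereal_inf_tmp => _ [s' [s'0 Hs'] <-]; rewrite lee_fin leNgt.
apply/negP => ss'.
(* Chosen so that 2^s' * e + e = c^2 / K: a cover this cheap contradicts [energy_cover]. *)
pose e := c ^+ 2 / K / (2 `^ s' + 1).
have e0 : 0 < e by rewrite !divr_gt0 ?exprn_gt0// ltr_wpDr ?powR_ge0.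
have [_ [U [XU Ud] <-] Ue] : exists2 x, [set (\sum_(0 <= i <oo) diam_pow s' (U i))%E |
    U in [set U : nat -> set 'rV[R]_(m + 1) |
      graph f `<=` \bigcup_i U i /\ forall i, (ediam (U i) <= (2^-1 ^+ 1)%:E)%E]] x & (x < e%:E)%E.
  apply: ereal_inf_lt.
  have : (hausdorff_premeasure s' (2^-1 ^+ 1) (graph f) <= 0)%E.
    by rewrite -Hs'; apply: premeasure_le_measure; rewrite exprn_gt0.
  by move=> /le_lt_trans; apply; rewrite lte_fin.
have /choice[k hk] : forall i, exists k, U i !=set0 ->
    (ediam (U i) < (2^-1 ^+ k)%:E)%E /\
    (((2^-1 ^+ k) `^ s')%:E <= (2 `^ s')%:E * diam_pow s' (U i) + (e / (2 ^ i.+1)%:R)%:E)%E.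
  move=> i; have [U0|U0] := pselect (U i !=set0); last by exists 0%N.
  have ei : 0 < e / (2 ^ i.+1)%:R by rewrite divr_gt0// ltr0n expn_gt0.
  have Uk0 : (ediam (U i) < (2^-1 ^+ 0)%:E)%E.
    by apply: (le_lt_trans (Ud i)); rewrite lte_fin expr1 expr0; lra.
  by have [k [_ ? ?]] := ediam_dyadic U0 s'0 ei Uk0; exists k.
pose d i := fine (ediam (U i)).
have dE i : U i !=set0 -> ediam (U i) = (d i)%:E.
  move=> U0; rewrite /d fineK// fin_numElt (lt_le_trans _ (ediam_ge0 U0)) ?ltNy0//=.
  by have [h _] := hk i U0; apply: (lt_trans h); rewrite ltry.
(* Half of the slack: [U i] widened by less than [r i] on each side is relatively open in the graph,
   and coordinates in it still differ by at most 2^-(k i). *)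
pose r i := (2^-1 ^+ k i - d i) / 2.
have r0 i : U i !=set0 -> 0 < r i.
  move=> U0; have [h _] := hk i U0; move: h; rewrite dE// lte_fin /r; lra.
pose O i := [set x : X | exists2 u, U i u & forall l, `|gpt f x 0 l - u 0 l| < r i].
have oO i : open (O i).
  rewrite openE => x [u Uu xu]; rewrite /interior.
  have : \forall y \near x, forall l, `|gpt f y 0 l - u 0 l| < r i.
    apply: (@filter_forall _ _ _ (nbhs x) (nbhs_filter x)) => l.
    have C := @gpt_continuous f l cf x.
    apply: (C [set t | `|t - u 0 l| < r i]).
    have : (fun t : R => `|t - u 0 l|) @ (gpt f x 0 l) --> `|gpt f x 0 l - u 0 l|.
      by apply: cvg_norm; apply: cvgB; [exact: cvg_id|exact: cvg_cst].
    by move=> /cvgr_lt; apply; exact: xu.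
  by apply: (@filterS _ (nbhs x) (nbhs_filter x)) => y yl; exists u.
have covO : [set: X] `<=` \bigcup_(i in [set: nat]) O i.
  move=> x _; have [i _ Ui] := XU (gpt f x) (ex_intro2 _ _ x I erefl).
  exists i => //; exists (gpt f x) => // l; rewrite subrr normr0.
  by apply: r0; exists (gpt f x).
have [N covN] : exists N, forall x, exists2 i, (i < N)%N & O i x.
  have /compact_near_coveringP/(_ nat \oo (fun n x => exists2 i, (i < n)%N & O i x)) :=
    compact_set_type cX.
  case => [x _|N _ h]; last by exists N => x; exact: (h N (leqnn N) x I).
  have [i _ Oi] := covO x I.
  exists (O i, [set n | (i < n)%N]) => /=.
    split; last by exists i.+1.
    by apply: open_nbhs_nbhs; split.
  by move=> [y n] [/= Oy iN]; exists i.
pose A i (x : X) := `[< O i x >].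
pose M0 := (\max_(i < N) k i).+1.
have [M M0M EM] := EK M0.
have kM i : (i < N)%N -> (k i < M)%N.
  move=> iN; apply: leq_trans M0M; rewrite ltnS.
  exact: (leq_bigmax (Ordinal iN)).
have near i p q : (i < N)%N -> A i p -> A i q -> graph_near f (k i) p q.
  move=> _ /asboolP[u Uu pu] /asboolP[v Uv qv].
  have U0 : U i !=set0 by exists u.
  have coord l : `|gpt f p 0 l - gpt f q 0 l| <= 2^-1 ^+ k i.
    have := ediam_ub Uu Uv; rewrite dE// lee_fin => uvd.
    have uv := le_trans (edist_coord u v l) uvd.
    have := pu l; have := qv l; rewrite distrC /r.
    move: uv; rewrite !(ler_norml, ltr_norml) => /andP[? ?] /andP[? ?] /andP[? ?].
    by apply/andP; split; lra.
  apply/andP; split.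
    apply/forallP => l; have := coord (lshift 1 l); by rewrite !row_mxEl.
  by have := coord (rshift m ord0); rewrite !row_mxEr !mxE.
have Acov p : exists2 i, (i < N)%N & A i p.
  by have [i iN Oi] := covN p; exists i => //; apply/asboolP.
have := energy_cover (w0 M) c0 K0 (cw M) EM Acov near kM.
apply/negP; rewrite -ltNge.
have pos i : (0 <= (2 `^ s')%:E * diam_pow s' (U i))%E.
  by apply: mule_ge0; [rewrite lee_fin powR_ge0|exact: diam_pow_ge0].
have rhs0 i : (0 <= (2 `^ s')%:E * diam_pow s' (U i) + (e / (2 ^ i.+1)%:R)%:E)%E.
  by apply: adde_ge0 => //; rewrite lee_fin divr_ge0//; exact: ltW.
rewrite -lte_fin.
apply: (@le_lt_trans _ _ (\sum_(0 <= i < N) ((2 `^ s')%:E * diam_pow s' (U i) + (e / (2 ^ i.+1)%:R)%:E))%E).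
  rewrite big_mkord -sumEFin big_mkcond/=; apply: lee_sum => i _.
  case: ifPn => // /hasP[p _ /asboolP[u Uu _]].
  have [_ h] := hk i (ex_intro _ u Uu); apply: le_trans h.
  rewrite lee_fin; apply: ger_powR; last exact: ltW.
  by rewrite exprn_gt0//= exprn_ile1//; lra.
apply: (@le_lt_trans _ _ (\sum_(0 <= i <oo) ((2 `^ s')%:E * diam_pow s' (U i) + (e / (2 ^ i.+1)%:R)%:E))%E).
  exact: nneseries_lim_ge.
apply: (@le_lt_trans _ _ (\sum_(0 <= i <oo) ((2 `^ s')%:E * diam_pow s' (U i)) + e%:E)%E).
  by apply: epsilon_trick => //; exact: ltW.
rewrite nneseriesZl; last by move=> *; exact: diam_pow_ge0.
rewrite (_ : c ^+ 2 / K = 2 `^ s' * e + e); last first.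
  rewrite /e; field; rewrite !gt_eqF// ltr_wpDr ?powR_ge0//.
rewrite EFinD lteD2rE// (EFinM (2 `^ s') e).
rewrite lte_pmul2l//.
Qed.

End energy_dimension.

(** * The random series *)

Section random_series.
Context {R : realType} {E : completeNormedModType R}.
Variable psi : nat -> E.
Hypothesis psi_le1 : forall j, `|psi j| <= 1.

(** This is 1 / ((j + 1) (j + 2)), written as a difference so that the tails telescope. *)
Definition amp (j : nat) : R := j.+1%:R^-1 - j.+2%:R^-1.

Lemma ampE j : amp j = (j.+1%:R * j.+2%:R)^-1.
Proof.
have h1 : j.+1%:R != 0 :> R by rewrite pnatr_eq0.
have h2 : j.+2%:R != 0 :> R by rewrite pnatr_eq0.
have e : j.+2%:R = j.+1%:R + 1 :> R by rewrite natr1.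
rewrite /amp; move: h1 h2; rewrite e; move: (j.+1%:R : R) => x h1 h2.
by field; rewrite h1 h2.
Qed.

Lemma amp_gt0 j : 0 < amp j.
Proof. by rewrite ampE invr_gt0 mulr_gt0. Qed.

Lemma amp_sum J J' : (J <= J')%N ->
  \sum_(J <= j < J') amp j = J.+1%:R^-1 - J'.+1%:R^-1.
Proof.
move=> JJ; under eq_bigr do rewrite /amp -opprB.
rewrite sumrN (telescope_sumr (fun j => j.+1%:R^-1))//; exact: opprB.
Qed.

Definition unit_seq (t : nat -> R) := forall j, 0 <= t j <= 1.

Definition partial (t : nat -> R) (J : nat) : E :=
  \sum_(0 <= j < J) (amp j * t j) *: psi j.

Definition rseries (t : nat -> R) : E := lim (partial t @ \oo).

Lemma partial_dist t J J' : unit_seq t -> (J <= J')%N ->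
  `|partial t J' - partial t J| <= J.+1%:R^-1 - J'.+1%:R^-1.
Proof.
move=> t01 JJ; rewrite -amp_sum// /partial (big_cat_nat (n := J))//= addrAC subrr add0r.
apply: (le_trans (ler_norm_sum _ _ _)); apply: ler_sum => j _.
have /andP[t0 t1] := t01 j.
rewrite normrZ ger0_norm ?mulr_ge0 ?(ltW (amp_gt0 j))// -[leRHS]mulr1.
by rewrite -mulrA ler_pM ?mulr_ge0 ?(ltW (amp_gt0 j)) ?mulr_ile1.
Qed.

Lemma cvg_partial t : unit_seq t -> cvg (partial t @ \oo).
Proof.
move=> t01; apply/cauchy_cvgP/cauchy_ballP => e e0.
have [N hN] : exists N, forall n, (N <= n)%N -> n.+1%:R^-1 < e / 2.
  exists (Num.truncn (e / 2)^-1) => n Nn.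
  rewrite invf_plt ?posrE ?divr_gt0//.
  by apply: lt_le_trans (truncnS_gt _) _; rewrite ler_nat ltnS.
exists ([set x | exists2 n, (N <= n)%N & partial t n = x],
        [set x | exists2 n, (N <= n)%N & partial t n = x]).
  by split; exists N => // n /= Nn; exists n.
have near n : (N <= n)%N -> `|partial t n - partial t N| < e / 2.
  move=> Nn; apply: le_lt_trans (partial_dist t01 Nn) _.
  by apply: le_lt_trans (hN N (leqnn N)); rewrite lerBlDr lerDl invr_ge0.
move=> [x y] [/= [n Nn <-] [n' Nn' <-]].
rewrite -ball_normE /ball_/= (_ : _ - _ = (partial t n - partial t N) -
  (partial t n' - partial t N)); last by rewrite opprB addrA subrK.
by rewrite (splitr e) (le_lt_trans (ler_normB _ _))// ltrD ?near.
Qed.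

Lemma rseries_dist t J : unit_seq t -> `|rseries t - partial t J| <= J.+1%:R^-1.
Proof.
move=> t01; apply/ler_addgt0Pr => e e0.
have /cvgrPdist_lt/(_ e e0)[N _ hN] : partial t @ \oo --> rseries t := cvg_partial t01.
have /= h1 := hN (maxn N J) (leq_maxl _ _).
have h2 := partial_dist t01 (leq_maxr N J).
rewrite (_ : _ - _ = (partial t (maxn N J) - partial t J) +
  (rseries t - partial t (maxn N J))); last by rewrite [RHS]addrC addrA subrK.
apply: (le_trans (ler_normD _ _)); rewrite lerD ?(ltW h1)//.
by apply: (le_trans h2); rewrite lerBlDr lerDl invr_ge0.
Qed.

End random_series.

(** An ultrafilter that contains [A] contains one ball of every finite net, so it is Cauchy. *)
Lemma totally_bounded_compact {R : realType} {E : completeNormedModType R} (A : set E) :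
  closed A ->
  (forall e : R, 0 < e -> exists s : seq E, forall x, A x ->
     exists2 c, c \in s & `|c - x| < e) ->
  compact A.
Proof.
move=> clA tbA; rewrite compact_ultra => F FU FA.
have FF : ProperFilter F by exact: ultra_proper.
have small (e : R) : 0 < e -> exists c : E, F (ball c e).
  move=> e0; have [s hs] := tbA e e0; apply: contrapT => /forallNP h.
  have FC c : F (~` ball c e) by have [/h|] := in_ultra_setVsetC (ball c e) FU.
  have Fs : forall r : seq E, F [set x | forall c, c \in r -> ~ ball c e x].
    elim=> [|c r IH]; first by apply: (filterS _ filterT).
    apply: filterS (filterI (FC c) IH) => x [ncx rx] d.
    by rewrite inE => /orP[/eqP ->|/rx].
  have [x [Ax sx]] := filter_ex (filterI FA (Fs s)).
  have [c cs cx] := hs x Ax; apply: (sx c cs).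
  by rewrite -ball_normE.
have : cauchy F.
  apply/cauchy_ballP => e e0.
  have e2 : 0 < e / 2 by rewrite divr_gt0.
  have [c Fc] := small (e / 2) e2.
  exists (ball c (e / 2), ball c (e / 2)) => // -[x y] [/= cx cy].
  by rewrite (splitr e); apply: ball_triangle (ball_sym cx) cy.
move=> /cauchy_cvg /cvg_ex[x Fx]; exists x; split => //.
apply: clA => B Bx; have FAB : F (A `&` B) by apply: filterI FA _; exact: Fx.
by have [y ABy] := filter_ex FAB; exists y.
Qed.

(** * Digits of a uniform random number *)

Section trunc.
Context {R : realType}.

(** Dividing by [n] drops the least significant digit, so truncations to different lengths yield the
    same leading digits. For negative [x] both sides are 0. *)
Lemma truncn_div (x : R) (n : nat) : (0 < n)%N ->
  (Num.truncn (n%:R * x) %/ n = Num.truncn x)%N.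
Proof.
move=> n0; have nR : 0 < n%:R :> R by rewrite ltr0n.
have [x0|x0] := ltP x 0.
  have -> : Num.truncn (n%:R * x) = 0%N.
    by apply/truncn0Pn; rewrite -ltNge (lt_trans _ ltr01)// pmulr_rlt0.
  have -> : Num.truncn x = 0%N.
    by apply/truncn0Pn; rewrite -ltNge (lt_trans _ ltr01).
  by rewrite div0n.
have nx0 : 0 <= n%:R * x by rewrite mulr_ge0// ltW.
have /andP[k1 k2] := truncn_itv x0; set k := Num.truncn x in k1 k2 *.
have h1 : (k * n <= Num.truncn (n%:R * x))%N.
  by rewrite truncn_ge_nat// natrM mulrC ler_pM2l.
have h2 : (Num.truncn (n%:R * x) < k.+1 * n)%N.
  by rewrite truncn_lt_nat// natrM mulrC ltr_pM2r.
by apply/eqP; rewrite eqn_leq -ltnS ltn_divLR// h2 leq_divRL.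
Qed.

Lemma measurable_truncn (a : R) (B : set nat) : 0 < a ->
  measurable ([set u : R | B (Num.truncn (a * u))] : set (measurableTypeR R)).
Proof.
move=> a0.
have mle n : measurable ([set u : R | (Num.truncn (a * u) <= n)%N] : set (measurableTypeR R)).
  rewrite (_ : [set _ | _] = `]-oo, (n.+1%:R / a)[%classic); first exact: measurable_itv.
  by apply/seteqP; split => u /=; rewrite truncn_le_nat in_itv/= ltr_pdivlMr// mulrC.
have meq n : measurable ([set u : R | Num.truncn (a * u) = n] : set (measurableTypeR R)).
  case: n => [|n].
    rewrite (_ : [set _ | _] = [set u : R | (Num.truncn (a * u) <= 0)%N])//.
    by apply/seteqP; split => u /=; [move=> ->|rewrite leqn0 => /eqP].
  rewrite (_ : [set _ | _] = [set u : R | (Num.truncn (a * u) <= n.+1)%N] `\`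
     [set u : R | (Num.truncn (a * u) <= n)%N]); first exact: measurableD.
  apply/seteqP; split => u /=; first by move=> ->; rewrite ltnn.
  by move=> [h1 /negP]; rewrite -ltnNge => h2; apply/eqP; rewrite eqn_leq h1.
rewrite (_ : [set _ | _] = \bigcup_(n in B) [set u : R | Num.truncn (a * u) = n]).
  by apply: bigcup_measurable => n _; exact: meq.
by apply/seteqP; split => u /=; [move=> Bu; exists (Num.truncn (a * u))|move=> [n Bn ->]].
Qed.

Definition unif : probability (measurableTypeR R) R := uniform_prob (@ltr01 R).

Lemma unif_le_lebesgue (U : set (measurableTypeR R)) : measurable U ->
  (unif U <= lebesgue_measure (U `&` `[0%R, 1%R]))%E.
Proof.
move=> mU; rewrite /unif /= /uniform_prob integral_uniform_pdf.
have mUI : measurable (U `&` `[0%R, 1%R]) by apply: measurableI => //; exact: measurable_itv.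
apply: (@le_trans _ _ (\int[lebesgue_measure]_(x in U `&` `[0%R, 1%R]) cst 1%E x)%E).
  apply: ge0_le_integral => //.
  - by move=> x _; rewrite lee_fin uniform_pdf_ge0.
  - apply/measurable_EFinP; apply: (measurable_funS measurableT) => //.
    exact: measurable_uniform_pdf.
  - by move=> x _; rewrite lee_fin /uniform_pdf; case: ifP => // _; rewrite subr0 invr1.
by rewrite integral_cst// mul1e.
Qed.

(** The point 1 is excluded because its truncation at resolution [N] is [N] itself, outside the
    range [i < N] of digit strings. *)
Lemma unif_setC01 : (unif (~` `[0%R, 1%R[) = 0)%E.
Proof.
pose Z : set (measurableTypeR R) := ~` `[0%R, 1%R[%classic.
have mZ : measurable Z by apply: measurableC; exact: measurable_itv.
rewrite -/Z.
apply/eqP; rewrite eq_le measure_ge0 andbT.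
apply: (le_trans (unif_le_lebesgue mZ)).
rewrite (_ : Z `&` _ = [set 1%R]) ?lebesgue_measure_set1//.
apply/seteqP; split => u /=; rewrite /Z /= !in_itv/=.
  move=> [/negP nu /andP[u0 u1]]; apply/eqP; rewrite eq_le u1/= leNgt.
  by apply: contra nu => ->; rewrite u0.
by move=> ->; rewrite ltxx ler01 lexx.
Qed.

Lemma unif_truncn_le (N : nat) (B : pred nat) : (0 < N)%N ->
  (unif [set u | B (Num.truncn (N%:R * u))] <=
   ((\sum_(i < N) (B i)%:R) / N%:R)%:E)%E.
Proof.
move=> N0; have NR : 0 < N%:R :> R by rewrite ltr0n.
pose A i : set (measurableTypeR R) :=
  if B i then `[(i%:R / N%:R), (i.+1%:R / N%:R)[%classic else set0.
have mA i : measurable (A i) by rewrite /A; case: ifP => // _; exact: measurable_itv.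
have A_le i : (unif (A i) <= ((B i)%:R / N%:R)%:E)%E.
  rewrite /A; case: ifP => _; last by rewrite measure0 mul0r.
  apply: (le_trans (unif_le_lebesgue (measurable_itv _))).
  apply: (@le_trans _ _ (lebesgue_measure `[(i%:R / N%:R : R), (i.+1%:R / N%:R)[%classic)).
    by apply: le_measure; rewrite ?inE//; apply: measurableI.
  rewrite lebesgue_measure_itv /= lte_fin.
  case: ifP => _; last by rewrite lee_fin divr_ge0.
  by rewrite -EFinB lee_fin -mulrBl -natr1 addrAC subrr add0r.
pose Z : set (measurableTypeR R) := ~` `[0%R, 1%R[%classic.
have mZ : measurable Z by apply: measurableC; exact: measurable_itv.
have Z0 := unif_setC01.
have mAs : measurable (\big[setU/set0]_(i < N) A i) by apply: bigsetU_measurable.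
apply: (@le_trans _ _ (unif (Z `|` \big[setU/set0]_(i < N) A i))).
  apply: le_measure; rewrite ?inE; [exact: (measurable_truncn [set i | B i] NR)|exact: measurableU|].
  move=> u /= Bu; have [u01|] := boolP (u \in `[0%R, 1%R[); last by move=> h; left; apply/negP.
  right; rewrite -bigcup_mkord.
  move: u01; rewrite in_itv/= => /andP[u0 u1].
  have Nu0 : 0 <= N%:R * u by rewrite mulr_ge0// ltW.
  exists (Num.truncn (N%:R * u)); first by rewrite /= truncn_lt_nat// -[ltRHS]mulr1 ltr_pM2l.
  rewrite /A Bu /= in_itv/= ler_pdivrMr// ltr_pdivlMr// mulrC.
  by apply: truncn_itv; rewrite mulrC.
apply: (le_trans (measureU2 _ mZ mAs)); rewrite [X in (X + _)%E]Z0 add0e.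
apply: (le_trans (Boole_inequality _ (fun i _ => mA i))).
by rewrite mulr_suml -sumEFin; apply: lee_sum => i _; exact: A_le.
Qed.

End trunc.

Section bounded_linear_form.
Context {R : realType} {E : completeNormedModType R}.
Variable L : E -> R.
Hypothesis L_linear : forall a g h, L (a *: g + h) = a * L g + L h.
(** The constant 2 is that of the increments [f p - f q], to which the section is applied. *)
Hypothesis L_bound : forall g, `|L g| <= 2 * `|g|.

Lemma linear_formB g h : L (g - h) = L g - L h.
Proof. by rewrite addrC -scaleN1r L_linear mulN1r addrC. Qed.

Lemma linear_form_continuous : continuous L.
Proof.
move=> g; apply/cvgrPdist_lt => e e0.
apply/nbhs_ballP; exists (e / 2); first by rewrite /= divr_gt0.
move=> h; rewrite -ball_normE /ball_/= => gh; rewrite -linear_formB.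
by apply: le_lt_trans (L_bound _) _; lra.
Qed.

Lemma closed_linear_form (z r : R) : closed [set g : E | `|L g + z| <= r].
Proof.
rewrite (_ : [set g | _] = (fun g => `|L g + z|) @^-1` [set x | x <= r])//.
apply: preimage_closed; last exact: closed_le.
move=> g _; apply: cvg_norm; apply: cvgD; [exact: linear_form_continuous|exact: cvg_cst].
Qed.

End bounded_linear_form.

Section law.
Context {R : realType} {E : completeNormedModType R}.
Variables (psi : nat -> E) (n : nat -> nat).
Hypothesis psi_le1 : forall j, `|psi j| <= 1.
Hypothesis n_gt0 : forall j, (0 < n j)%N.

Let N := radix_prod n.

Let N0 J : (0 < N J)%N. Proof. exact: radix_prod_gt0. Qed.

Definition digit (u : R) (j : nat) : R :=
  (Num.truncn ((N j.+1)%:R * u) %% n j)%:R / (n j)%:R.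

Lemma digit_unit u : unit_seq (digit u).
Proof.
move=> j; rewrite /digit divr_ge0//= ler_pdivrMr ?ltr0n// mul1r ler_nat.
by rewrite ltnW// ltn_pmod.
Qed.

(** The vector version of [walk], with the same recursion, so that a linear form of it is a [walk]
    with coefficients [amp j * L (psi j)]. *)
Fixpoint ewalk (J i : nat) : E :=
  if J is J'.+1 then
    ewalk J' (i %/ n J') + (amp J' * ((i %% n J')%:R / (n J')%:R)) *: psi J'
  else 0.

Lemma partial_digit u J :
  partial psi (digit u) J = ewalk J (Num.truncn ((N J)%:R * u)).
Proof.
elim: J => [|J IH]; first by rewrite /partial big_geq.
rewrite /partial big_nat_recr//= -/(partial _ _ _) IH; congr (ewalk _ _ + _).
by rewrite -(truncn_div ((N J)%:R * u) (n_gt0 J)) mulrA -natrM (mulnC (n J)).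
Qed.

Definition rpoint (u : measurableTypeR R) : borelType E := rseries psi (digit u).

Lemma rpoint_dist u J : `|rpoint u - ewalk J (Num.truncn ((N J)%:R * u))| <= J.+1%:R^-1.
Proof. by rewrite -partial_digit; apply: rseries_dist => //; exact: digit_unit. Qed.

Lemma invS_lt (e : R) : 0 < e -> exists J : nat, J.+1%:R^-1 < e.
Proof.
move=> e0; exists (Num.truncn e^-1).
by rewrite invf_plt ?posrE// truncnS_gt.
Qed.

(** [rpoint u] lies in the open set [V] exactly when, for some [J], the ball known to contain it
    from its first [J] digits lies in [V]; the latter depends on a truncation only. *)
Lemma open_rpoint (V : set E) : open V -> measurable [set u | V (rpoint u)].
Proof.
move=> oV; pose A J : set nat := [set i | forall g, `|g - ewalk J i| <= J.+1%:R^-1 -> V g].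
rewrite (_ : [set u | _] = \bigcup_J [set u | A J (Num.truncn ((N J)%:R * u))]).
  by apply: bigcup_measurable => J _; apply: measurable_truncn; rewrite ltr0n.
apply/seteqP; split => [u /= Vu|u [J _]]; last by apply; exact: rpoint_dist.
have /nbhs_ballP[e /= e0 eV] : nbhs (rpoint u : E) V by exact: open_nbhs_nbhs.
have [J hJ] := invS_lt (divr_gt0 e0 (ltr0n R 2)).
exists J => // g gJ; apply: eV; rewrite -ball_normE /ball_/=.
have := rpoint_dist u J; move: gJ; set w := ewalk _ _ => h1 h2.
rewrite (_ : _ - _ = (rpoint u - w) - (g - w)); last by rewrite opprB addrA subrK.
apply: le_lt_trans (ler_normB _ _) _; rewrite (splitr e).
by apply: ltrD; [exact: le_lt_trans h2 hJ|exact: le_lt_trans h1 hJ].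
Qed.

Lemma measurable_rpoint : measurable_fun setT rpoint.
Proof.
move=> _ Y mY; rewrite setTI.
pose H : set (set E) := [set B | measurable (rpoint @^-1` B)].
have : <<s [set V : set E | open V] >> `<=` H.
  apply: smallest_sub; last by move=> V oV; exact: open_rpoint.
  split => [|B HB|F HF]; rewrite /H /=.
  - by rewrite preimage_set0; exact: measurable0.
  - by rewrite setTD preimage_setC; exact: measurableC.
  - by rewrite preimage_bigcup; exact: bigcupT_measurable.
by apply; exact: mY.
Qed.

HB.instance Definition _ := isMeasurableFun.Build _ _ _ _ rpoint measurable_rpoint.

Definition law : probability (borelType E) R := distribution unif rpoint.

(** The partial sums with [J] digits are finitely many and form a net of radius 1 / (J + 1) for all
    values. *)
Lemma law_compact : compactly_supported law.
Proof.
pose A := [set rpoint u | u in `[0%R, 1%R[%classic] : set E.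
exists (closure A).
  apply: totally_bounded_compact; first exact: closed_closure.
  move=> e e0; have e2 : 0 < e / 2 by rewrite divr_gt0.
  have [J hJ] := invS_lt e2.
  exists [seq ewalk J i | i <- iota 0 (N J)] => x clx.
  have [_ [[u /= u01 <-]]] := clx _ (nbhsx_ballx x _ e2).
  rewrite -ball_normE /ball_/= => xu.
  exists (ewalk J (Num.truncn ((N J)%:R * u))).
    apply: map_f; rewrite mem_iota/= add0n.
    move: u01; rewrite in_itv/= => /andP[u0 u1].
    by rewrite truncn_lt_nat ?mulr_ge0// -[ltRHS]mulr1 ltr_pM2l// ltr0n.
  have := rpoint_dist u J; set w := ewalk _ _; rewrite distrC => h1.
  rewrite (_ : w - x = (w - rpoint u) - (x - rpoint u)); last by rewrite opprB addrA subrK.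
  apply: le_lt_trans (ler_normB _ _) _; rewrite (splitr e).
  by apply: ltrD; [exact: le_lt_trans h1 hJ|exact: xu].
apply/eqP; rewrite eq_le measure_ge0 andbT -(unif_setC01 (R := R)).
change (unif (rpoint @^-1` (~` closure A)) <= unif (~` `[0%R, 1%R[))%E.
apply: le_measure; rewrite ?inE.
- by apply: open_rpoint; apply: closed_openC; exact: closed_closure.
- by apply: measurableC; exact: measurable_itv.
move=> u /= nu u01; apply: nu; apply: subset_closure.
by exists u.
Qed.

Section small_ball.
Variable L : E -> R.
Hypothesis L_linear : forall a g h, L (a *: g + h) = a * L g + L h.
Hypothesis L_bound : forall g, `|L g| <= 2 * `|g|.

Lemma linear_ewalk (z : R) J i :
  L (ewalk J i) + z = walk n (fun j => amp j * L (psi j)) (L 0 + z) J i.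
Proof.
elim: J i => //= J IH i.
by rewrite addrC [ewalk _ _ + _]addrC L_linear -IH; ring.
Qed.

(* The constant 5: truncating the series doubles the radius r, an interval of
   length 4 r results, and rounding to a digit of size a j / n j <= r adds r. *)
Lemma rpoint_small_ball (j : nat) (r c z : R) :
  0 < c -> c <= L (psi j) -> 0 < r -> (n j)%:R^-1 <= r ->
  (unif [set u | (`|L (rpoint u) + z| <= r)%R] <= (5 * r / (amp j * c))%:E)%E.
Proof.
move=> c0 cL r0 nr.
have LB := linear_formB L_linear.
have [J0 hJ0] := invS_lt (divr_gt0 r0 (ltr0n R 2)).
(* [J] must exceed [j] to involve that digit, and be so large that the tail changes the value of [L]
   by at most [r]. *)
pose J := maxn J0 j.+1.
have hJ : J.+1%:R^-1 < r / 2.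
  apply: le_lt_trans hJ0; rewrite lef_pV2 ?posrE// ler_nat ltnS; exact: leq_maxl.
have jJ : (j < J)%N by exact: leq_maxr.
pose a i := amp i * L (psi i).
have a0 : 0 < a j by rewrite mulr_gt0 ?amp_gt0// (lt_le_trans c0).
pose B i := `|walk n a (L 0 + z) J i| <= 2 * r.
have mS : measurable [set u | `|L (rpoint u) + z| <= r].
  have cl := @closed_linear_form _ _ L L_linear L_bound z r.
  rewrite -[[set u | _]]setCK; apply: measurableC.
  by apply: (open_rpoint (V := ~` [set g : E | `|L g + z| <= r])); exact: closed_openC.
apply: (@le_trans _ _ (unif [set u | B (Num.truncn ((N J)%:R * u))])).
  apply: le_measure; rewrite ?inE//.
    by apply: (measurable_truncn [set i | B i]); rewrite ltr0n.
  move=> u /= h; rewrite /B -linear_ewalk.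
  have := L_bound (rpoint u - ewalk J (Num.truncn ((N J)%:R * u))).
  rewrite LB; have := rpoint_dist u J; set w := ewalk _ _ => h1 h2.
  have := ler_normB (L (rpoint u) + z) (L (rpoint u) - L w).
  rewrite (_ : L (rpoint u) + z - _ = L w + z); last by ring.
  move=> h3; apply: (le_trans h3).
  rewrite mulr_natl mulr2n lerD//; apply: (le_trans h2).
  apply: (@le_trans _ _ (2 * J.+1%:R^-1)); first by rewrite ler_wpM2l.
  by move: hJ; move: (J.+1%:R^-1) => q; lra.
apply: (le_trans (unif_truncn_le B (N0 J))); rewrite lee_fin ler_pdivrMr ?ltr0n//.
have r2 : 0 <= 2 * r by lra.
apply: (le_trans (walk_small_ball n_gt0 (L 0 + z) jJ a0 r2)).
apply: ler_wpM2r => //.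
have ac : amp j * c <= a j by rewrite ler_wpM2l// ltW ?amp_gt0.
have a1 : a j <= 1.
  have h1 : L (psi j) <= 2.
    apply: le_trans (ler_norm _) _; apply: le_trans (L_bound _) _.
    by have := psi_le1 j; lra.
  rewrite /a ampE mulrC ler_pdivrMr ?mulr_gt0// mul1r (le_trans h1)// -natrM ler_nat.
  by rewrite mulSn; case: j {h1 jJ J hJ a a0 B mS ac cL nr} => // j; rewrite addSn addnS.
have nj0 : 0 < (n j)%:R^-1 :> R by rewrite invr_gt0 ltr0n.
have ac0 : 0 < amp j * c by rewrite mulr_gt0// amp_gt0.
have h3 : a j / (n j)%:R <= r.
  by rewrite (le_trans _ nr)// ler_piMl// ltW.
apply: (@le_trans _ _ (5 * r / a j)).
  by rewrite ler_pM2r ?invr_gt0//; lra.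
by rewrite ler_wpM2l ?mulr_ge0 ?(ltW r0)// lef_pV2 ?posrE.
Qed.

End small_ball.
End law.

(** * Prevalence from bounded energies *)

Section mean.
Context d (T : measurableType d) (R : realType) (mu : probability T R).

Definition mean_le (F : T -> R) (b : R) : Prop :=
  [/\ measurable_fun setT F, forall u, 0 <= F u & (\int[mu]_u (F u)%:E <= b%:E)%E].

Lemma mean_le_indic (A : set T) (a b : R) : measurable A -> 0 <= a ->
  (mu A <= b%:E)%E -> mean_le (fun u => a * \1_A u) (a * b).
Proof.
move=> mA a0 Ab; split => [|u|].
- by apply: measurable_funM => //; exact: measurable_indic.
- by rewrite mulr_ge0// indicE ler0n.
under eq_integral do rewrite EFinM.
rewrite ge0_integralZl_EFin//; last by apply/measurable_EFinP; exact: measurable_indic.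
rewrite integral_indic// setIT EFinM.
by apply: lee_wpmul2l => //; rewrite lee_fin.
Qed.

Lemma mean_le_scale (a : R) F b : 0 <= a -> mean_le F b ->
  mean_le (fun u => a * F u) (a * b).
Proof.
move=> a0 [mF F0 Fb]; split => [|u|].
- exact: measurable_funM.
- by rewrite mulr_ge0.
under eq_integral do rewrite EFinM.
rewrite ge0_integralZl_EFin//; last exact/measurable_EFinP.
  by rewrite EFinM; apply: lee_wpmul2l => //; rewrite lee_fin.
by move=> u _; rewrite lee_fin.
Qed.

Lemma mean_le_sum (I : Type) (s : seq I) (F : I -> T -> R) (b : I -> R) :
  (forall i, mean_le (F i) (b i)) ->
  mean_le (fun u => \sum_(i <- s) F i u) (\sum_(i <- s) b i).
Proof.
move=> Fb; split => [|u|].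
- by apply: measurable_sum => i; have [] := Fb i.
- by apply: sumr_ge0 => i _; have [] := Fb i.
under eq_integral do rewrite -sumEFin.
rewrite ge0_integral_sum//.
- by rewrite -sumEFin; apply: lee_sum => i _; have [] := Fb i.
- by move=> i; apply/measurable_EFinP; have [] := Fb i.
- by move=> i u _; rewrite lee_fin; have [] := Fb i.
Qed.

Lemma mean_le_markov F b (K : R) : 0 < K -> mean_le F b ->
  measurable [set u | K < F u] /\ (mu [set u | (K < F u)%R] <= (b / K)%:E)%E.
Proof.
move=> K0 [mF F0 Fb].
have mA : measurable [set u | K < F u].
  rewrite (_ : [set u | _] = setT `&` F @^-1` `]K, +oo[%classic).
    by apply: mF => //; exact: measurable_itv.
  by rewrite setTI; apply/seteqP; split => u /=; rewrite in_itv/= andbT.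
split => //.
have Ki : 0 < K^-1 by rewrite invr_gt0.
rewrite EFinM muleC -lee_pdivrMl// invrK.
apply: le_trans Fb.
rewrite -[X in (_ * mu X)%E]setIT -(integral_indic mu measurableT mA).
rewrite -ge0_integralZl_EFin//; last 2 first.
- by apply/measurable_EFinP; exact: measurable_indic.
- exact: ltW.
apply: ge0_le_integral => //.
- by move=> x _; rewrite -EFinM lee_fin mulr_ge0 ?(ltW K0)// indicE ler0n.
- under eq_fun do rewrite -EFinM.
  by apply/measurable_EFinP; apply: measurable_funM => //; exact: measurable_indic.
- exact/measurable_EFinP.
- move=> x _; rewrite -EFinM lee_fin indicE.
  have [/set_mem/= h|_] := boolP (x \in _); first by rewrite mulr1 ltW.
  by rewrite mulr0.
Qed.

(* Markov's inequality bounds the probability that F M > K for all M >= M0,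
   uniformly in M0. *)
Lemma mean_le_null (F : nat -> T -> R) (b : R) : (forall M, mean_le (F M) b) ->
  let A := [set u | forall K : nat, exists M0, forall M, (M0 <= M)%N -> K%:R < F M u] in
  measurable A /\ mu A = 0%E.
Proof.
move=> Fb A.
(* Thresholds [K.+1] are positive, as Markov's inequality requires; the intersection over [K] is
   unaffected. *)
pose A1 K M0 := \bigcap_(M in [set M | (M0 <= M)%N]) [set u | K.+1%:R < F M u].
pose A2 K := \bigcup_M0 A1 K M0.
have mF K M : measurable [set u | K.+1%:R < F M u].
  by have [] := mean_le_markov (ltr0Sn R K) (Fb M).
have mA1 K M0 : measurable (A1 K M0) by apply: bigcap_measurable => [|M _]; [exists M0 => /=|exact: mF].
have mA2 K : measurable (A2 K) by exact: bigcupT_measurable.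
have AE : A = \bigcap_K A2 K.
  apply/seteqP; split => u /= h.
    by move=> K _; have [M0 hM] := h K.+1; exists M0 => // M M0M; exact: hM.
  move=> K; have [M0 _ hM] := h K I; exists M0 => M M0M.
  by apply: lt_trans (hM M M0M); rewrite ltr_nat.
have mA : measurable A by rewrite AE; exact: bigcapT_measurable.
have b0 : 0 <= b.
  have [_ F0] := Fb 0%N; rewrite -lee_fin; apply: le_trans.
  by apply: integral_ge0 => u _; rewrite lee_fin.
split => //; apply/eqP; rewrite eq_le measure_ge0 andbT.
apply/lee_addgt0Pr => e e0; rewrite add0e.
pose K := Num.truncn (b / e).
apply: (@le_trans _ _ (mu (A2 K))).
  by apply: le_measure; rewrite ?inE// AE; exact: bigcap_inf.
have cv : (mu \o A1 K) x @[x --> \oo] --> mu (A2 K).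
  apply: nondecreasing_cvg_mu => //; first exact: mA2.
  move=> M M' MM'.
  by apply/subsetPset => u h M'' /= M'M''; apply: h; exact: leq_trans M'M''.
rewrite -(cvg_lim (@ereal_hausdorff R) cv); apply: lime_le; first by apply/cvg_ex; exists (mu (A2 K)).
apply: nearW => M0 /=.
have [mB Bb] := mean_le_markov (ltr0Sn R K) (Fb M0).
apply: (@le_trans _ _ (mu [set u | K.+1%:R < F M0 u])).
  by apply: le_measure; rewrite ?inE// => u; apply => /=.
apply: (le_trans Bb); rewrite lee_fin ler_pdivrMr ?ltr0n//.
by rewrite mulrC -ler_pdivrMr// ltW// truncnS_gt.
Qed.

End mean.

Section prevalence_criterion.
Context {R : realType} {m : nat} {X : set 'rV[R]_m} (cX : compact X).
Local Notation E := (C1 R cX).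

Lemma C1_subE (f g : E) (x : X) : C1_fun (f - g) x = f x - g x.
Proof. by []. Qed.

Definition increment (p q : X) (f : E) : R := f p - f q.

Lemma increment_linear p q (a : R) (f g : E) :
  increment p q (a *: f + g) = a * increment p q f + increment p q g.
Proof.
have e x : C1_fun (a *: f + g) x = a * f x + g x by [].
by rewrite /increment !e; ring.
Qed.

Lemma increment_bound p q (f : E) : `|increment p q f| <= 2 * `|f|.
Proof.
rewrite /increment mulr_natl mulr2n; apply: (le_trans (ler_normB _ _)).
by apply: lerD; exact: C1_norm_ge.
Qed.

Lemma closed_increment p q (g : E) (r : R) :
  closed [set f : E | `|increment p q (f - g)| <= r].
Proof.
rewrite (_ : [set f | _] = [set f | `|increment p q f + - increment p q g| <= r]).
  exact: (closed_linear_form (increment_linear p q) (increment_bound p q)).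
by apply/seteqP; split => f /=; rewrite (linear_formB (increment_linear p q)).
Qed.

Lemma closed_graph_near k p q (g : E) : closed [set f : E | graph_near (C1_fun (f - g)) k p q].
Proof.
rewrite /graph_near; case: close; last first.
  by rewrite (_ : [set _ | _] = set0); [exact: closed0|apply/seteqP; split].
exact: closed_increment.
Qed.

Variables (psi : nat -> E) (n : nat -> nat).
Hypothesis psi_le1 : forall j, `|psi j| <= 1.
Hypothesis n_gt0 : forall j, (0 < n j)%N.

Let rp : R -> E := rpoint psi n.

Lemma measurable_graph_near k p q (g : E) :
  measurable ([set u | graph_near (C1_fun (rpoint psi n u - g)%R) k p q] : set (measurableTypeR R)).
Proof.
rewrite -[[set u | _]]setCK; apply: measurableC.
apply: (open_rpoint psi_le1 n_gt0 (V := ~` [set f : E | graph_near (C1_fun (f - g)) k p q])).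
exact/closed_openC/closed_graph_near.
Qed.

(** The exceptional Borel set is the union over [i] of the functions whose energies at exponent
    [s i] tend to infinity. Translating it by [g] replaces [rp u] by [rp u - g], and [B] does not
    depend on [g]; countably many exponents are handled by one and the same law. *)
Lemma prevalent_of_energy (B : nat -> X -> X -> R)
    (s c C : nat -> R) (pts : nat -> nat -> seq X) (w : nat -> nat -> X -> R)
    (G : set E) :
  (forall (g : E) (k : nat) (p q : X), (unif [set u | graph_near (C1_fun (rpoint psi n u - g)%R) k p q] <= (B k p q)%:E)%E) ->
  (forall i, [/\ 0 <= s i, 0 < c i, forall M p, 0 <= w i M p &
     forall M, c i <= \sum_(p <- pts i M) w i M p]) ->
  (forall i M, \sum_(p <- pts i M) \sum_(q <- pts i M) w i M p * w i M q *
     \sum_(k < M) ((2^-1 ^+ k) `^ s i)^-1 * B k p q <= C i) ->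
  (forall f : E, (forall i, ((s i)%:E <= dimH (graph f))%E) -> G f) ->
  prevalent G.
Proof.
move=> hB hi hC hG.
pose en i M (f : E) : R := energy (s i) M (pts i M) (w i M) (graph_near f).
have en_mean i M (g : E) : mean_le unif (fun u => en i M (rp u - g)) (C i).
  have [s0 c0 w0 _] := hi i.
  have : mean_le unif (fun u => en i M (rp u - g))
     (\sum_(p <- pts i M) \sum_(q <- pts i M) w i M p * w i M q *
     \sum_(k < M) ((2^-1 ^+ k) `^ s i)^-1 * B k p q).
    apply: mean_le_sum => p; apply: mean_le_sum => q.
    apply: mean_le_scale; first by rewrite mulr_ge0.
    apply: mean_le_sum => k.
    rewrite (_ : (fun u => _) = (fun u => ((2^-1 ^+ k) `^ s i)^-1 *
       \1_[set u | graph_near (C1_fun (rp u - g)%R) k p q] u)).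
      by apply: mean_le_indic; [exact: measurable_graph_near|rewrite invr_ge0 powR_ge0|exact: hB].
    apply/funext => u; rewrite indicE; congr (_ * _).
    by rewrite mem_setE.
  move=> [h1 h2 h3]; split => //; apply: le_trans h3 _.
  by rewrite lee_fin.
pose bad i : set E := [set f | forall K : nat, exists M0, forall M, (M0 <= M)%N -> K%:R < en i M f].
have bad_dim f i : ~ bad i f -> ((s i)%:E <= dimH (graph f))%E.
  have [s0 c0 w0 cw] := hi i.
  move=> /existsNP[K /forallNP h].
  apply: (@energy_dimH _ _ _ f (s i) (c i) K.+1%:R (pts i) (w i)) => //.
    exact: C1_fun_continuous.
  move=> M0; have /existsNP[M /not_implyP[M0M /negP]] := h M0.
  rewrite -leNgt => le; exists M => //; apply: (le_trans le).
  by rewrite ler_nat.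
have bad_null i (g : E) : measurable ([set u | bad i (rp u - g)%R] : set (measurableTypeR R)) /\
    (unif [set u | bad i (rp u - g)%R] = 0)%E.
  exact: (mean_le_null (fun M => en_mean i M g)).
have mbad i : measurable (bad i : set (borelType E)).
  (* For fixed weights the energy is a finite combination of indicators of closed sets, hence Borel
     in [f]. *)
  have men M (K : nat) : measurable ([set f | K%:R < en i M f] : set (borelType E)).
    have : measurable_fun setT (fun f : borelType E => en i M f).
      apply: measurable_sum => p; apply: measurable_sum => q.
      apply: measurable_funM => //; apply: measurable_sum => k.
      apply: measurable_funM => //.
      rewrite (_ : (fun f => _) = \1_[set f : borelType E | graph_near (f : E) k p q]).
        apply: measurable_indic; rewrite -[[set f | _]]setCK; apply: measurableC.
        apply: sub_sigma_algebra; apply: closed_openC.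
        have := @closed_graph_near k p q 0; congr closed; apply/seteqP.
        by split => f /=; rewrite subr0.
      by apply/funext => u; rewrite indicE mem_setE.
    move=> men; rewrite (_ : [set f | _] = setT `&` (fun f : borelType E => en i M f) @^-1` `]K%:R, +oo[%classic).
      by apply: men => //; exact: measurable_itv.
    by rewrite setTI; apply/seteqP; split => u /=; rewrite in_itv/= andbT.
  rewrite (_ : bad i = \bigcap_K \bigcup_M0 \bigcap_(M in [set M | (M0 <= M)%N]) [set f | K%:R < en i M f]).
    apply: bigcapT_measurable => K; apply: bigcupT_measurable => M0.
    by apply: bigcap_measurable => [|M _]; [exists M0 => /=|exact: men].
  apply/seteqP; split => f /= h K.
    by move=> _; have [M0 hM] := h K; exists M0 => // M; exact: hM.
  by have [M0 _ hM] := h K I; exists M0 => M; exact: hM.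
exists (\bigcup_i bad i); last first.
  move=> f Gf; apply: contrapT => nbad; apply: Gf; apply: hG => i.
  by apply: bad_dim => bf; apply: nbad; exists i.
split; first exact: bigcupT_measurable.
exists (law psi_le1 n_gt0); first exact: law_compact.
move=> g; change (unif (rp @^-1` [set (h + g)%R | h in \bigcup_i bad i]) = 0)%E.
rewrite (_ : rp @^-1` _ = \bigcup_i [set u | bad i (rp u - g)%R]); last first.
  apply/seteqP; split => u /=.
    by move=> [f [i _ bf] e]; exists i => //=; rewrite -[X in X - g]e addrK.
  by move=> [i _ bu]; exists (rp u - g); rewrite ?subrK//; exists i.
apply/eqP; rewrite eq_le measure_ge0 andbT.
apply: (@le_trans _ _ (\sum_(0 <= i <oo) unif [set u | bad i (rp u - g)%R])%E).
  apply: measure_sigma_subadditive => //.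
  - by move=> i; have [] := bad_null i g.
  - by apply: bigcupT_measurable => i; have [] := bad_null i g.
by rewrite eseries0// => i _ _; have [] := bad_null i g.
Qed.

End prevalence_criterion.

Section separation.
Context {R : realType} {m : nat} {X : set 'rV[R]_m} (cX : compact X).
Local Notation E := (C1 R cX).

Lemma close_half_le (k l : nat) (p q : 'rV[R]_m) : (l <= k)%N ->
  close (2^-1 ^+ k) p q -> close (2^-1 ^+ l) p q.
Proof.
move=> lk /forallP h; apply/forallP => i; apply: (le_trans (h i)).
by apply: ler_wiXn2l => //; lra.
Qed.

Lemma C1_uniform_continuity (f : E) (c : R) : 0 < c ->
  exists K, forall p q : X, close (2^-1 ^+ K) (set_val p) (set_val q) -> `|f p - f q| < c.
Proof.
move=> c0.
have /compact_near_coveringP/(_ nat \oo (fun n p => forall q : X,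
    close (2^-1 ^+ n) (set_val p) (set_val q) -> `|f p - f q| < c)) :=
  compact_set_type cX.
case => [x _|N _ h]; last by exists N => p; exact: (h N (leqnn N) p I).
have c2 : 0 < c / 2 by rewrite divr_gt0.
have : nbhs x [set y | `|f x - f y| < c / 2].
  have C := @C1_fun_continuous _ _ _ _ f x.
  apply: (C [set t | `|f x - t| < c / 2]).
  by apply/nbhs_ballP; exists (c / 2) => // t; rewrite -ball_normE.
rewrite nbhsE => -[V [[W oW WV] Vx] VB].
have : nbhs (set_val x) W by apply: open_nbhs_nbhs; split => //; have := Vx; rewrite -WV.
move=> /nbhs_ballP[e /= e0 eW].
have e2 : 0 < e / 2 by rewrite divr_gt0.
have [N hN] := half_pow_lt e2.
exists ([set y : X | forall i, `|set_val x 0 i - set_val y 0 i| < e / 2], [set n | (N <= n)%N]) => /=.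
  split; last by exists N.
  have C := @initial_continuous _ _ (set_val : X -> 'rV[R]_m) x.
  apply: (C [set y | forall i, `|set_val x 0 i - y 0 i| < e / 2]).
  apply/nbhs_ballP; exists (e / 2) => // y [_ xy] i.
  by have := xy 0 i; rewrite -ball_normE.
move=> [y n] [/= xy Nn] q yq.
have inW (z : X) : (forall i, `|set_val x 0 i - set_val z 0 i| < e) -> `|f x - f z| < c / 2.
  move=> h; apply: VB; rewrite -WV; apply: eW; split => // i j.
  by rewrite -ball_normE /ball_/= (ord1 i).
have h1 : `|f x - f y| < c / 2.
  by apply: inW => i; apply: lt_trans (xy i) _; lra.
have h2 : `|f x - f q| < c / 2.
  apply: inW => i; have /forallP/(_ i) := yq; have := hN n Nn; have := xy i.
  have := ler_normD (set_val x 0 i - set_val y 0 i) (set_val y 0 i - set_val q 0 i).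
  rewrite addrA subrK; move: (2^-1 ^+ n) => a; lra.
rewrite (_ : f y - f q = (f x - f q) - (f x - f y)); last by ring.
by apply: (le_lt_trans (ler_normB _ _)); lra.
Qed.

(* B k p q stands for the supremum over all g of the probability that
   graph_near (F - g) k p q holds, F being the random function. *)
Definition admissible (psi : nat -> E) (c0 : R) (B : nat -> X -> X -> R) :=
  [/\ forall k p q, 0 <= B k p q <= 1,
      forall k p q, ~~ close (2^-1 ^+ k) (set_val p) (set_val q) -> B k p q = 0 &
      forall k p q j, c0 <= `|psi j p - psi j q| ->
        B k p q <= 5 / c0 * (j.+1%:R * j.+2%:R) * 2^-1 ^+ k].

(** The energy hypothesis ranges over every admissible [B], so that the estimates for concrete [psi]
    are free of probability. *)
Lemma prevalent_of_separation (psi : nat -> E) (c0 : R)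
    (s c C : nat -> R) (pts : nat -> nat -> seq X) (w : nat -> nat -> X -> R)
    (G : set E) :
  (forall j, `|psi j| <= 1) -> 0 < c0 ->
  (forall i, [/\ 0 <= s i, 0 < c i, forall M p, 0 <= w i M p &
     forall M, c i <= \sum_(p <- pts i M) w i M p]) ->
  (forall i M (B : nat -> X -> X -> R), admissible psi c0 B ->
     \sum_(p <- pts i M) \sum_(q <- pts i M) w i M p * w i M q *
       \sum_(k < M) ((2^-1 ^+ k) `^ s i)^-1 * B k p q <= C i) ->
  (forall f : E, (forall i, ((s i)%:E <= dimH (graph f))%E) -> G f) ->
  prevalent G.
Proof.
move=> psi1 c00 hi hC hG.
have /choice[n0 hn0] : forall j, exists K, forall p q : X,
    close (2^-1 ^+ K) (set_val p) (set_val q) -> `|psi j p - psi j q| < c0.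
  by move=> j; exact: C1_uniform_continuity.
pose n j := (2 ^ n0 j)%N.
have n_gt0 j : (0 < n j)%N by rewrite expn_gt0.
have nlt j k p q : c0 <= `|psi j p - psi j q| ->
    close (2^-1 ^+ k) (set_val p) (set_val q) -> (n j)%:R^-1 <= 2^-1 ^+ k :> R.
  move=> cj ck; rewrite natrX -exprVn; apply: ler_wiXn2l; [lra|lra|].
  rewrite leqNgt; apply/negP => kn.
  by have := hn0 j p q (close_half_le (ltnW kn) ck); rewrite ltNge cj.
pose P g k p q := unif [set u | graph_near (C1_fun (rpoint psi n u - g)%R) k p q].
have mP g k p q := measurable_graph_near psi1 n_gt0 k p q g.
have P01 g k p q : 0 <= fine (P g k p q) <= 1.
  rewrite fine_ge0 ?measure_ge0//= -lee_fin fineK ?fin_num_measure//.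
  exact: probability_le1.
pose B k p q := sup [set fine (P g k p q) | g in [set: E]].
have Bub k p q : has_ubound [set fine (P g k p q) | g in [set: E]].
  by exists 1 => _ [g _ <-]; have /andP[] := P01 g k p q.
have PB g k p q : fine (P g k p q) <= B k p q.
  by apply: ub_le_sup => //; exists g.
have Ble k p q b : (forall g, fine (P g k p q) <= b) -> B k p q <= b.
  move=> h; apply: ge_sup; first by exists (fine (P 0 k p q)), 0.
  by move=> _ [g _ <-].
apply: (prevalent_of_energy psi1 n_gt0 (B := B) _ hi _ hG).
  by move=> g k p q; rewrite -/(P g k p q) -[leLHS]fineK ?fin_num_measure// lee_fin.
move=> i M; apply: hC; split => [k p q|k p q nc|k p q j cj].
- apply/andP; split; last by apply: Ble => g; have /andP[] := P01 g k p q.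
  by apply: le_trans (PB 0 k p q); have /andP[] := P01 0 k p q.
- have P0 g : fine (P g k p q) = 0.
    rewrite /P (_ : [set u | _] = set0) ?measure0//.
    by apply/seteqP; split => u //=; rewrite /graph_near (negbTE nc).
  apply/eqP; rewrite eq_le; apply/andP; split; first by apply: Ble => g; rewrite P0.
  by rewrite -(P0 0) PB.
apply: Ble => g; rewrite -lee_fin fineK ?fin_num_measure//.
have [ck|nc] := boolP (close (2^-1 ^+ k) (set_val p) (set_val q)); last first.
  rewrite /P (_ : [set u | _] = set0) ?measure0.
    by rewrite lee_fin !mulr_ge0 ?invr_ge0 ?exprn_ge0 ?ltW.
  by apply/seteqP; split => u //=; rewrite /graph_near (negbTE nc).
have h0 : 0 < 2^-1 ^+ k :> R by rewrite exprn_gt0.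
have nk := nlt _ _ _ _ cj ck.
rewrite (_ : 5 / c0 * _ * _ = 5 * 2^-1 ^+ k / (amp j * c0)); last first.
  have h1 : j.+1%:R != 0 :> R by rewrite pnatr_eq0.
  have h2 : j.+2%:R != 0 :> R by rewrite pnatr_eq0.
  move: (j.+1%:R : R) (j.+2%:R : R) h1 h2 (@ampE R j) => a b h1 h2 ->.
  by field; rewrite h1 h2 gt_eqF.
have incrE p' q' (h : E) : increment p' q' h - increment p' q' g =
    C1_fun (h - g) p' - C1_fun (h - g) q'.
  by rewrite /increment !C1_subE; ring.
(* The small-ball estimate wants a positive value of the form at [psi j]; exchanging [p] and [q]
   changes its sign and leaves [graph_near] as it is. *)
have [cpos|cneg] : c0 <= psi j p - psi j q \/ c0 <= psi j q - psi j p.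
  by move: cj; rewrite ler_normr opprB => /orP.
- have := rpoint_small_ball psi1 n_gt0 (increment_linear p q) (increment_bound p q)
    (- increment p q g) c00 cpos h0 nk.
  congr (_ <= _)%E; congr (unif _); apply/seteqP.
  by split => u /=; rewrite /graph_near ck incrE.
- have := rpoint_small_ball psi1 n_gt0 (increment_linear q p) (increment_bound q p)
    (- increment q p g) c00 cneg h0 nk.
  congr (_ <= _)%E; congr (unif _); apply/seteqP.
  by split => u /=; rewrite /graph_near ck incrE distrC.
Qed.

End separation.

Section real_sums.
Context {R : realType}.

Lemma bernoulli_le (a : R) j : 0 <= a -> 1 + j%:R * a <= (1 + a) ^+ j.
Proof.
move=> a0; elim: j => [|j IH]; first by rewrite mul0r addr0 expr0.
rewrite exprS; apply: (@le_trans _ _ ((1 + a) * (1 + j%:R * a))).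
  rewrite -natr1; have : 0 <= j%:R * a * a by rewrite !mulr_ge0.
  by move: (j%:R : R) => b; lra.
by apply: ler_wpM2l => //; lra.
Qed.

Lemma geometric_le (z : R) M : 0 <= z < 1 -> \sum_(j < M) z ^+ j <= (1 - z)^-1.
Proof.
move=> /andP[z0 z1]; have z2 : 0 < 1 - z by lra.
rewrite -[leRHS]mul1r ler_pdivlMr// mulrC.
have := subrX1 z M; have : 0 <= z ^+ M by rewrite exprn_ge0.
by move: (z ^+ M) (\sum_(_ < _) _) => a b; lra.
Qed.

(** With [x = z ^+ 4], three of the factors [z ^+ j] absorb the three polynomial factors by
    Bernoulli's inequality, and the fourth leaves a geometric series. *)
Lemma poly_geometric_bounded (x : R) : 0 < x < 1 ->
  exists C, forall M, \sum_(j < M) j.+2%:R ^+ 3 * x ^+ j <= C.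
Proof.
move=> /andP[x0 x1].
pose z := x `^ 4^-1.
have z0 : 0 < z by rewrite powR_gt0.
have z4 : z ^+ 4 = x.
  by rewrite /z -powR_mulrn ?powR_ge0// -powRrM mulVf ?powRr1 ?ltW.
have z1 : z < 1.
  rewrite ltNge; apply/negP => z1; move: x1; rewrite -z4 ltNge => /negP; apply.
  exact: exprn_ege1.
pose a := z^-1 - 1.
have a0 : 0 < a by rewrite subr_gt0 invf_gt1.
have za : z^-1 = 1 + a by rewrite /a addrC subrK.
pose D := 2 + a^-1.
have D0 : 0 < D by rewrite addr_gt0// invr_gt0.
have key j : j.+2%:R * z ^+ j <= D.
  rewrite -ler_pdivlMr ?exprn_gt0// -exprVn za.
  apply: (@le_trans _ _ (D * (1 + j%:R * a))).
    rewrite /D -addn2 natrD (_ : (2 + a^-1) * _ = 2 + j%:R * 2 * a + a^-1 + j%:R); last first.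
      by field; rewrite gt_eqF.
    have : 0 <= j%:R * 2 * a by rewrite !mulr_ge0// ltW.
    have : 0 < a^-1 by rewrite invr_gt0.
    by move: (j%:R * 2 * a) (a^-1) (j%:R : R) => u v t; lra.
  by apply: ler_wpM2l; [exact: ltW|apply: bernoulli_le; exact: ltW].
exists (D ^+ 3 * (1 - z)^-1) => M.
apply: (@le_trans _ _ (\sum_(j < M) D ^+ 3 * z ^+ j)).
  apply: ler_sum => j _; rewrite -z4 -exprM mulnC exprM.
  rewrite (_ : (z ^+ j) ^+ 4 = (z ^+ j) ^+ 3 * z ^+ j); last by rewrite -exprSr.
  rewrite mulrA -exprMn; apply: ler_wpM2r; first by rewrite exprn_ge0// ltW.
  by apply: lerXn2r; rewrite ?nnegrE ?key ?mulr_ge0 ?exprn_ge0 ?ltW.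
rewrite -mulr_sumr; apply: ler_wpM2l; first by rewrite exprn_ge0// ltW.
by apply: geometric_le; rewrite z1 ltW.
Qed.

Lemma half_powE (k : nat) (a : R) : (2^-1 ^+ k) `^ a = (2^-1 `^ a) ^+ k :> R.
Proof.
by rewrite -powR_mulrn ?invr_ge0// powRAC powR_mulrn// powR_ge0.
Qed.

Lemma half_pow_lt1 (a : R) : 0 < a -> 0 < (2^-1 : R) `^ a < 1.
Proof.
move=> a0; rewrite powR_gt0//=.
have h : (2^-1 : R) `^ a < 1 `^ a.
  by apply: gt0_ltr_powR => //; rewrite ?nnegrE ?invr_ge0//; lra.
by rewrite powR1 in h.
Qed.

(** The factor 2^-k of the small-ball estimate lowers the exponent by one: the origin of the 1 in
    [dimH X + 1]. *)
Lemma half_pow_split (k : nat) (s : R) :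
  ((2^-1 ^+ k) `^ s)^-1 * 2^-1 ^+ k = ((2^-1 ^+ k) `^ (s - 1))^-1.
Proof.
have h0 : 0 < 2^-1 ^+ k :> R by rewrite exprn_gt0.
rewrite powRB; last by apply/implyP => _; rewrite gt_eqF.
by rewrite powRr1 ?ltW// invf_div mulrC.
Qed.

End real_sums.

(** * Sets of positive dimension *)

Section dyadic_cells.
Context {R : realType} {m : nat} {X : set 'rV[R]_m}.

Definition cell (k : nat) (x : X) : {ffun 'I_m -> int} :=
  [ffun i => Num.floor (2 ^+ k * (set_val x) 0 i)].

Lemma floor_half (y z : R) :
  Num.floor (2 * y) = Num.floor (2 * z) -> Num.floor y = Num.floor z.
Proof.
move=> e; apply/esym/floor_def.
have /andP[y1 y2] := floor_itv y.
set N := Num.floor y in y1 y2 *.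
have h1 : 2 * N <= Num.floor (2 * z).
  by rewrite -e floor_ge_int intrM ler_pM2l.
have h2 : Num.floor (2 * z) < 2 * (N + 1).
  by rewrite -e floor_lt_int intrM ltr_pM2l.
move: h1 h2; rewrite floor_ge_int floor_lt_int !intrM.
by rewrite ler_pM2l// ltr_pM2l// => -> ->.
Qed.

Lemma cell_refine k (x y : X) : cell k.+1 x = cell k.+1 y -> cell k x = cell k y.
Proof.
move=> /ffunP e; apply/ffunP => i; rewrite !ffunE; have := e i.
by rewrite !ffunE exprS -!mulrA; exact: floor_half.
Qed.

Lemma cell_close k (x y : X) : cell k x = cell k y ->
  forall i, `|(set_val x) 0 i - (set_val y) 0 i| <= 2^-1 ^+ k.
Proof.
move=> /ffunP e i; have := e i; rewrite !ffunE => ei.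
have /andP[x1 x2] := floor_itv (2 ^+ k * (set_val x) 0 i).
have /andP[y1 y2] := floor_itv (2 ^+ k * (set_val y) 0 i).
rewrite ei in x1 x2.
rewrite -(ler_pM2l (_ : 0 < 2 ^+ k)) ?exprn_gt0// -exprMn mulfV// expr1n.
rewrite -[X in X * _](ger0_norm (_ : 0 <= 2 ^+ k)) ?exprn_ge0// -normrM mulrBr.
move: x1 x2 y1 y2; rewrite intrD ler_norml.
move: (2 ^+ k * _) (2 ^+ k * _) (Num.floor _)%:~R => a b c *.
by apply/andP; split; lra.
Qed.

(** The index [e i] in ['I_3] codes the offsets -1, 0, 1 of a neighbouring cell, whence the factor
    [3 ^ m] in the Frostman bound. *)
Lemma close_cell k (x y : X) : close (2^-1 ^+ k) (set_val x) (set_val y) ->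
  exists e : {ffun 'I_m -> 'I_3},
    cell k y = [ffun i => cell k x i + ((e i : nat)%:Z - 1)].
Proof.
move=> /forallP xy.
have ex i : exists e : 'I_3, cell k y i = cell k x i + ((e : nat)%:Z - 1).
  have := xy i; rewrite -(ler_pM2l (_ : 0 < 2 ^+ k)) ?exprn_gt0// -exprMn mulfV// expr1n.
  rewrite -[X in X * _](ger0_norm (_ : 0 <= 2 ^+ k)) ?exprn_ge0// -normrM mulrBr.
  rewrite !ffunE; set b := 2 ^+ k * _; set a := 2 ^+ k * _.
  rewrite ler_norml => /andP[ab1 ab2].
  have /andP[a1 a2] := floor_itv a.
  have h1 : Num.floor a - 1 <= Num.floor b.
    by rewrite floor_ge_int intrB; lra.
  have h2 : Num.floor b < Num.floor a + 2.
    by rewrite floor_lt_int intrD; move: a2; rewrite intrD; lra.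
  have hn : (absz (Num.floor b - Num.floor a + 1)%R < 3)%N by lia.
  by exists (Ordinal hn); rewrite /=; lia.
have [e he] := choice ex.
exists [ffun i => e i]; apply/ffunP => i; rewrite he [RHS]ffunE.
by congr (_ + (_ - _)); rewrite ffunE.
Qed.

Lemma compact_coord_bounded : compact X ->
  exists B : nat, forall (x : X) i, `|(set_val x) 0 i| <= B%:R.
Proof.
move=> /compact_bounded[M [_ hM]].
exists (Num.truncn (`|M| + 1)).+1 => x i.
apply: (@le_trans _ _ `|set_val x|).
  by rewrite [leRHS]mx_normrE; apply: (le_bigmax _ (fun j => `|(set_val x : 'rV[R]_m) j.1 j.2|) (0, i)).
apply: (@le_trans _ _ (`|M| + 1)); last exact/ltW/truncnS_gt.
apply: (hM (`|M| + 1)); last exact: set_valP.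
by rewrite (le_lt_trans (ler_norm M))// ltrDl.
Qed.

Lemma cell_range : compact X -> exists rg : nat -> seq {ffun 'I_m -> int},
  (forall k, uniq (rg k)) /\ (forall k x, cell k x \in rg k).
Proof.
move=> /compact_coord_bounded[B hB].
pose b k := (2 ^ k * B)%N.
pose sh k (f : {ffun 'I_m -> 'I_(b k + b k).+1}) : {ffun 'I_m -> int} :=
  [ffun i => (f i : nat)%:Z - (b k)%:Z].
exists (fun k => undup [seq sh k f | f <- enum {ffun 'I_m -> 'I_(b k + b k).+1}]).
split => [k|k x]; first exact: undup_uniq.
rewrite mem_undup; apply/mapP.
have ex i : exists e : 'I_(b k + b k).+1, cell k x i = (e : nat)%:Z - (b k)%:Z.
  rewrite ffunE; set a := 2 ^+ k * _.
  have : `|a| <= (b k)%:R.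
    rewrite (_ : (b k)%:R = 2 ^+ k * B%:R :> R); last by rewrite natrM natrX.
    rewrite /a normrM (ger0_norm (_ : 0 <= 2 ^+ k)) ?exprn_ge0//.
    by apply: ler_wpM2l; [exact: exprn_ge0|exact: hB].
  rewrite ler_norml => /andP[a1 a2].
  have h1 : - (b k)%:Z <= Num.floor a by rewrite floor_ge_int intrN.
  have h2 : Num.floor a < (b k)%:Z + 1.
    by rewrite floor_lt_int intrD (le_lt_trans a2)// ltrDl.
  have hn : (absz (Num.floor a + (b k)%:Z)%R < (b k + b k).+1)%N by lia.
  by exists (Ordinal hn); rewrite /=; lia.
have [e he] := choice ex.
exists [ffun i => e i]; first by rewrite mem_enum.
by apply/ffunP => i; rewrite he /sh ffunE ffunE.
Qed.

(** The content bound applies to the cells of [D], whose diameters are at most m * 2^-k, and so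
    bounds their capacities from below. [Q] bounds the mass through the cells of level 0,
    independently of [N]. *)
Lemma finite_frostman (t : R) : compact X -> 0 < t -> hausdorff_measure t X <> 0%E ->
  exists c Q : R, [/\ 0 < c, 0 <= Q & forall N, exists (pts : seq X) (w : X -> R),
    [/\ forall p, 0 <= w p, c <= \sum_(p <- pts) w p, \sum_(p <- pts) w p <= Q &
      forall j (p : X), (j <= N)%N ->
        \sum_(q <- pts | close (2^-1 ^+ j) (set_val p) (set_val q)) w q <=
        (3 ^ m)%:R * (2^-1 ^+ j) `^ t]].
Proof.
move=> cX t0 /(hausdorff_content t0)[c0 c00 hc0].
have [rg [rg_uniq cell_rg]] := cell_range cX.
pose c k : R := (2^-1 ^+ k) `^ t.
have c_gt0 k : 0 < c k by rewrite powR_gt0// exprn_gt0.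
(* [m.+1] rather than [m] keeps the constant positive for every [m]. *)
pose mt : R := (m.+1%:R) `^ t.
have mt0 : 0 < mt by rewrite powR_gt0.
exists (c0 / mt), ((size (rg 0))%:R * c 0); split.
- by rewrite divr_gt0.
- by rewrite mulr_ge0// ltW.
move=> N; have [pts [w [D [w0 Dcov Dsum wQ wle]]]] :=
  frostman_weights c_gt0 rg_uniq cell_rg cell_refine N.
exists pts, w; split => // [|j p jN].
  apply: le_trans Dsum; rewrite ler_pdivrMr//.
  pose U i : set 'rV[R]_m := if (i < size D)%N then
    [set set_val x | x in [set x : X | cell (nth (0%N, [ffun=> 0]) D i).1 x =
       (nth (0%N, [ffun=> 0]) D i).2]] else set0.
  have covU : X `<=` \bigcup_i U i.
    move=> x Xx; pose y : X := SigSub (mem_set Xx).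
    have hx := Dcov y.
    exists (find (fun d => cell d.1 y == d.2) D) => //.
    rewrite /U -has_find hx; exists y => //=.
    by have /eqP := nth_find (0%N, [ffun=> 0]) hx.
  have := hc0 U covU; rewrite (@eseries_finite _ _ (size D)); last first.
  - by move=> i Di; rewrite /U ltnNge Di/= diam_pow0.
  - by move=> i; exact: diam_pow_ge0.
  move=> h; rewrite -lee_fin; apply: (le_trans h).
  rewrite mulr_suml (big_nth (0%N, [ffun=> 0])) -sumEFin !big_mkord.
  apply: lee_sum => i _; rewrite /U ltn_ord.
  set d := nth _ D i.
  apply: (@le_trans _ _ ((m%:R * 2^-1 ^+ d.1) `^ t)%:E).
    apply: diam_pow_le; [exact: ltW|by rewrite mulr_ge0 ?exprn_ge0|].
    apply: ediam_le => _ _ [x /= xd <-] [y /= yd <-]; rewrite lee_fin.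
    apply: edist_le; first by rewrite exprn_ge0.
    by apply: cell_close; rewrite xd.
  rewrite lee_fin powRM ?exprn_ge0// mulrC; apply: ler_wpM2l; first exact: ltW.
  by apply: ge0_ler_powR; [exact: ltW|rewrite nnegrE|rewrite nnegrE|rewrite ler_nat].
apply: (@le_trans _ _ (\sum_(e : {ffun 'I_m -> 'I_3})
  \sum_(q <- pts | cell j q == [ffun i => cell j p i + ((e i : nat)%:Z - 1)]) w q)).
  rewrite (exchange_big_dep xpredT)//= big_mkcond/=; apply: ler_sum => q _.
  case: ifP => [/close_cell[e he]|_]; last exact: sumr_ge0.
  by rewrite (bigD1 e) ?he//= lerDl sumr_ge0.
apply: (@le_trans _ _ (\sum_(e : {ffun 'I_m -> 'I_3}) c j)).
  by apply: ler_sum => e _; exact: wle.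
by rewrite sumr_const card_ffun !card_ord mulr_natl.
Qed.

End dyadic_cells.

(** * Trigonometric functions and energies in positive dimension *)

Section waves.
Context {R : realType} {m : nat} {X : set 'rV[R]_m} (cX : compact X).
Local Notation E := (C1 R cX).

Lemma sum_leq_indic (M j : nat) : (\sum_(k < M) (k <= j) = minn M j.+1)%N.
Proof. by elim: M => [|M IH]; rewrite ?big_ord0 ?big_ord_recr/= ?IH; lia. Qed.

Section single_dimension.
Variables (psi : nat -> E) (c0 : R) (A : nat).
Hypothesis c00 : 0 < c0.
Hypothesis psi_sep : forall j p q, close (2^-1 ^+ j) (set_val p) (set_val q) ->
  ~~ close (2^-1 ^+ j.+1) (set_val p) (set_val q) ->
  exists2 n : nat, (n.+2 <= A * j.+2)%N & c0 <= `|psi n p - psi n q|.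

(** Up to polynomial factors, the points not separated from a given one before level [j] have weight
    2^(-j t), and the kernel at level [j] is 2^(j (s - 1)); [s < t + 1] makes the sum over [j]
    geometric. *)
Lemma frostman_energy (t s : R) : 0 < t -> 1 <= s < t + 1 ->
  hausdorff_measure t X <> 0%E ->
  exists (c C : R) (pts : nat -> seq X) (w : nat -> X -> R),
  [/\ 0 < c, forall M p, 0 <= w M p, forall M, c <= \sum_(p <- pts M) w M p &
    forall M B, admissible psi c0 B ->
     \sum_(p <- pts M) \sum_(q <- pts M) w M p * w M q *
       \sum_(k < M) ((2^-1 ^+ k) `^ s)^-1 * B k p q <= C].
Proof.
move=> t0 /andP[s1 st] Ht.
have [c [Q [c1 Q0 hF]]] := finite_frostman cX t0 Ht.
pose D := 5 / c0 * A%:R ^+ 2.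
have D0 : 0 <= D by rewrite mulr_ge0 ?divr_ge0 ?exprn_ge0// ltW.
pose rho : R := 2^-1 `^ (t + 1 - s).
have rho01 : 0 < rho < 1 by apply: half_pow_lt1; lra.
have [C3 hC3] := poly_geometric_bounded rho01.
(* [Q] enters for level 0, where every pair is unseparated and closeness gives nothing. *)
pose T := (3 ^ m)%:R + Q.
have T0 : 0 <= T by rewrite addr_ge0.
have x0 a k : 0 < (2^-1 ^+ k) `^ a :> R by rewrite powR_gt0// exprn_gt0.
(* The weights live at the scale N M, so much finer than M that the pairs which
   are never separated have a negligible weight. *)
have /choice[N hN] : forall M, exists N, (2^-1 ^+ N) `^ t <= (2^-1 ^+ M) `^ (s + 1) :> R.
  move=> M; have t01 : 0 <= (2^-1 : R) `^ t < 1 by have /andP[/ltW -> ->] := @half_pow_lt1 R t t0.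
  have [N h] := expr_lt_eps t01 (x0 (s + 1) M).
  by exists N; rewrite (half_powE N) ltW// h.
have /choice[pw hpw] : forall M, exists pw : seq X * (X -> R),
    [/\ forall p, 0 <= pw.2 p, c <= \sum_(p <- pw.1) pw.2 p, \sum_(p <- pw.1) pw.2 p <= Q &
      forall j (p : X), (j <= N M)%N ->
        \sum_(q <- pw.1 | close (2^-1 ^+ j) (set_val p) (set_val q)) pw.2 q <=
        (3 ^ m)%:R * (2^-1 ^+ j) `^ t].
  by move=> M; have [pts [w h]] := hF (N M); exists (pts, w).
exists c, (Q * (D * T * C3 + T)), (fun M => (pw M).1), (fun M => (pw M).2).
split=> [//|M p|M|M B [B01 B0 Bsep]].
- by have [h _ _ _] := hpw M.
- by have [_ h _ _] := hpw M.
have [w0 _ wQ wclose] := hpw M.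
set pts := (pw M).1 in wQ wclose *; set w := (pw M).2 in w0 wQ wclose *.
(* Level [j] tests the scale [j.+1], so that a pair first separated at [j > 0] is still close at
   scale [j]. *)
pose sep j (p q : X) := ~~ close (2^-1 ^+ j.+1) (set_val p) (set_val q).
pose K p q := \sum_(k < M) ((2^-1 ^+ k) `^ s)^-1 * B k p q.
(* Two factors [j.+2] stem from the amplitudes, the third counts the scales [k <= j]; beyond them
   [B] vanishes. *)
pose tau j := if (j < N M)%N then D * j.+2%:R ^+ 3 * ((2^-1 ^+ j) `^ (s - 1))^-1
   else M%:R * ((2^-1 ^+ M) `^ s)^-1.
pose theta j := T * (2^-1 ^+ j) `^ t.
have tau0 j : 0 <= tau j.
  rewrite /tau; case: ifP => _; apply: mulr_ge0; rewrite ?invr_ge0 ?powR_ge0//.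
  by apply: mulr_ge0 => //; rewrite exprn_ge0.
have xmono (a : R) k l : 0 <= a -> (k <= l)%N ->
    ((2^-1 ^+ k) `^ a)^-1 <= ((2^-1 ^+ l) `^ a)^-1 :> R.
  move=> a0 kl; rewrite lef_pV2 ?posrE//; apply: ge0_ler_powR => //.
  - by rewrite nnegrE exprn_ge0.
  - by rewrite nnegrE exprn_ge0.
  - by apply: ler_wiXn2l => //; lra.
have Ksep j p q : (j < N M)%N -> unsep sep j p q -> sep j p q -> K p q <= tau j.
  move=> jN un sj; rewrite /tau jN.
  set V := ((2^-1 ^+ j) `^ (s - 1))^-1.
  have V0 : 0 <= V by rewrite invr_ge0 powR_ge0.
  have DV : 0 <= D * j.+2%:R ^+ 2 * V.
    by apply: mulr_ge0 => //; apply: mulr_ge0 => //; rewrite exprn_ge0.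
  apply: (@le_trans _ _ (\sum_(k < M) (k <= j)%N%:R * (D * j.+2%:R ^+ 2 * V))).
    apply: ler_sum => k _; have [kj|jk] := leqP k j; last first.
      rewrite B0 ?mulr0 ?mul0r//; apply: contra sj; exact: close_half_le.
    rewrite mul1r.
    have [ck|nc] := boolP (close (2^-1 ^+ k) (set_val p) (set_val q)); last first.
      by rewrite B0// mulr0.
    have cj : close (2^-1 ^+ j) (set_val p) (set_val q).
      (* For [j = 0] closeness at scale 0 does not follow from [un], but there [k = 0] and it is
         [ck]. *)
      case: (posnP j) => [j0|j0]; first by move: kj ck; rewrite j0 leqn0 => /eqP ->.
      move: un => /allP/(_ j.-1); rewrite mem_iota/= add0n ltn_predL j0 => /(_ isT).
      by rewrite negbK prednK.
    have [n nA cn] := psi_sep cj sj.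
    apply: (@le_trans _ _ (((2^-1 ^+ k) `^ s)^-1 * (D * j.+2%:R ^+ 2 * 2^-1 ^+ k))).
      apply: ler_wpM2l; first by rewrite invr_ge0 powR_ge0.
      apply: (le_trans (Bsep k p q n cn)); apply: ler_wpM2r; first by rewrite exprn_ge0.
      rewrite /D -[leRHS]mulrA; apply: ler_wpM2l; first by rewrite divr_ge0// ltW.
      rewrite -exprMn -!natrM -natrX ler_nat -mulnn.
      exact: leq_mul (leq_trans (leqnSn _) nA) nA.
    rewrite mulrCA half_pow_split; apply: ler_wpM2l.
      by apply: mulr_ge0 => //; rewrite exprn_ge0.
    by apply: xmono => //; lra.
  rewrite -mulr_suml -natr_sum sum_leq_indic.
  rewrite [leRHS](_ : _ = j.+2%:R * (D * j.+2%:R ^+ 2 * V)); last by ring.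
  apply: ler_wpM2r => //.
  by rewrite ler_nat (leq_trans (geq_minr _ _)).
have Kun p q : unsep sep (N M) p q -> K p q <= tau (N M).
  move=> _; rewrite /tau ltnn mulr_natl.
  apply: (@le_trans _ _ (\sum_(k < M) ((2^-1 ^+ M) `^ s)^-1)).
    apply: ler_sum => k _; have /andP[Bk0 Bk1] := B01 k p q.
    rewrite -[leRHS]mulr1; apply: ler_pM => //.
    by apply: xmono; [lra|exact: ltnW].
  by rewrite sumr_const card_ord.
have wth j p : (j <= N M)%N -> \sum_(q <- pts | unsep sep j p q) w q <= theta j.
  move=> jN; case: (posnP j) => [j0|j0].
    rewrite j0 /theta expr0 powR1 mulr1.
    apply: (@le_trans _ _ Q); last by rewrite lerDr.
    apply: le_trans wQ; rewrite big_mkcond/=; exact: ler_sum.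
  apply: (@le_trans _ _ ((3 ^ m)%:R * (2^-1 ^+ j) `^ t)); last first.
    by apply: ler_wpM2r; [exact: powR_ge0|rewrite lerDl].
  apply: le_trans (wclose j p jN); rewrite big_mkcond [leRHS]big_mkcond/=.
  apply: ler_sum => q _; case: ifP => [/allP/(_ j.-1)|_]; last by case: ifP.
  by rewrite mem_iota/= add0n ltn_predL j0 => /(_ isT); rewrite negbK prednK// => ->.
apply: (le_trans (pair_sum_bound w0 tau0 Ksep Kun wth)).
have S0 : 0 <= \sum_(j < (N M).+1) tau j * theta j.
  by apply: sumr_ge0 => j _; rewrite mulr_ge0// mulr_ge0// powR_ge0.
apply: (@le_trans _ _ (Q * \sum_(j < (N M).+1) tau j * theta j)).
  by apply: ler_wpM2r.
apply: ler_wpM2l => //; rewrite big_ord_recr/=; apply: lerD.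
  apply: (@le_trans _ _ (D * T * \sum_(j < N M) j.+2%:R ^+ 3 * rho ^+ j)).
    rewrite mulr_sumr; apply: ler_sum => j _; rewrite /tau ltn_ord /theta.
    rewrite /rho -half_powE (_ : t + 1 - s = t - (s - 1)); last by ring.
    rewrite powRB; last by apply/implyP => _; rewrite gt_eqF// exprn_gt0.
    by rewrite le_eqVlt; apply/orP; left; apply/eqP; ring.
  by apply: ler_wpM2l; [exact: mulr_ge0|exact: hC3].
rewrite /tau ltnn /theta mulrCA -[leRHS]mulr1; apply: ler_wpM2l => //.
apply: (@le_trans _ _ (M%:R * ((2^-1 ^+ M) `^ s)^-1 * (2^-1 ^+ M) `^ (s + 1))).
  apply: ler_wpM2l; last exact: hN.
  by apply: mulr_ge0; rewrite ?invr_ge0 ?powR_ge0.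
rewrite powRD; last by apply/implyP => _; rewrite gt_eqF// exprn_gt0.
rewrite powRr1 ?exprn_ge0// mulrA mulfVK ?gt_eqF//.
rewrite -ler_pdivlMr ?exprn_gt0// mul1r -exprVn invrK -natrX ler_nat.
exact/ltnW/ltn_expl.
Qed.

End single_dimension.

Hypothesis m_gt0 : (0 < m)%N.

(* For n./2 = k * m + i, the wave n is the cosine (n even) or the sine (n odd)
   of 2^k times the i-th coordinate. *)
Definition wave_index (n : nat) : 'I_m := Ordinal (ltn_pmod n./2 m_gt0).

Definition wave_fun (n : nat) (x : X) : R :=
  (if odd n then sin else cos) (2 ^+ (n./2 %/ m) * (set_val x) 0 (wave_index n)).

Lemma wave_fun_continuous n : continuous (wave_fun n).
Proof.
have -> : wave_fun n = (if odd n then sin else cos) \o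
    (fun M : 'rV[R]_m => 2 ^+ (n./2 %/ m) * M 0 (wave_index n)) \o set_val by [].
move=> x; apply: continuous_comp; first exact: initial_continuous.
apply: continuous_comp; last by case: odd; [exact: continuous_sin|exact: continuous_cos].
apply: (@continuous_comp _ _ _ (fun M : 'rV[R]_m => M 0 (wave_index n)) ( *%R (2 ^+ (n./2 %/ m)))).
  exact: coord_continuous.
exact: mulrl_continuous.
Qed.

Definition wave (n : nat) : E :=
  exist _ (wave_fun n) ((contpredP _).2 (@wave_fun_continuous n)).

Lemma wave_le1 n : `|wave n| <= 1.
Proof.
apply: C1_norm_le => // x; rewrite /C1_fun /= /wave_fun.
by case: odd; [exact: sin_max|exact: cos_max].
Qed.

Definition wave_gap : R := Num.sqrt (1 - cos 1).

Lemma cos1_lt1 : cos 1 < 1 :> R.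
Proof.
rewrite -[ltRHS]cos0 ltr_cos ?in_itv/= ?lexx ?ler01 ?pi_ge0 ?ltr01//.
by apply: le_trans (@pi_ge2 R); lra.
Qed.

Lemma wave_gap_gt0 : 0 < wave_gap.
Proof. by rewrite sqrtr_gt0 subr_gt0 cos1_lt1. Qed.

(** The chord between the two points of the unit circle has squared length 2 - 2 cos (a - b), which
    is at least 2 (1 - cos 1) because [cos] decreases up to pi, and pi is at least 2; one coordinate
    carries half of it. *)
Lemma sincos_gap (a b : R) : 1 <= `|a - b| <= 2 ->
  wave_gap <= `|cos a - cos b| \/ wave_gap <= `|sin a - sin b|.
Proof.
move=> /andP[ab1 ab2].
have c1 : cos (a - b) <= cos 1.
  rewrite -cos_norm; have p2 := @pi_ge2 R.
  rewrite leNgt ltr_cos ?in_itv/= -?leNgt//; apply/andP; split; lra.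
have e : (cos a - cos b) ^+ 2 + (sin a - sin b) ^+ 2 = 2 - 2 * cos (a - b).
  by rewrite cosB; have := cos2Dsin2 a; have := cos2Dsin2 b; rewrite !expr2; lra.
have sq (u : R) : 1 - cos 1 <= u ^+ 2 -> wave_gap <= `|u|.
  by move=> h; rewrite /wave_gap -sqrtr_sqr ler_sqrt ?sqr_ge0.
have [h|h] := leP (1 - cos 1) ((cos a - cos b) ^+ 2); first by left; exact: sq.
by right; apply: sq; lra.
Qed.

Lemma wave_sep j (p q : X) : close (2^-1 ^+ j) (set_val p) (set_val q) ->
  ~~ close (2^-1 ^+ j.+1) (set_val p) (set_val q) ->
  exists2 n : nat, (n.+2 <= (2 * m).+1 * j.+2)%N & wave_gap <= `|wave n p - wave n q|.
Proof.
move=> /forallP cj /forallPn[i]; rewrite -ltNge => ci.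
have hK k : 2^-1 ^+ k * 2 ^+ k = 1 :> R by rewrite -exprMn mulVf ?expr1n.
(* The coordinate [i] differs by between 2^-(j+1) and 2^-j, so at frequency 2^(j+1) the phases
   differ by between 1 and 2. *)
pose n (b : bool) := (((j.+1 * m + i).*2 + b)%N).
have n2 b : ((n b)./2 = j.+1 * m + i)%N by rewrite /n addnC half_bit_double.
have nodd b : odd (n b) = b by rewrite /n oddD odd_double; case: b.
have ndiv b : ((n b)./2 %/ m = j.+1)%N by rewrite n2 divnMDl// divn_small// addn0.
have nidx b : wave_index (n b) = i.
  by apply: val_inj; rewrite /= n2 modnMDl modn_small.
have nle b : ((n b).+2 <= (2 * m).+1 * j.+2)%N.
  by have := ltn_ord i; rewrite /n; case: b; nia.
have waveE b (x : X) : wave (n b) x = (if b then sin else cos) (2 ^+ j.+1 * (set_val x) 0 i).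
  by rewrite /C1_fun /= /wave_fun nodd ndiv nidx.
have := @sincos_gap (2 ^+ j.+1 * (set_val p) 0 i) (2 ^+ j.+1 * (set_val q) 0 i).
case.
  rewrite -mulrBr normrM (ger0_norm (_ : 0 <= 2 ^+ j.+1)) ?exprn_ge0//.
  have h1 : 2 ^+ j.+1 * 2^-1 ^+ j.+1 = 1 :> R by rewrite mulrC hK.
  have h2 : 2 ^+ j.+1 * 2^-1 ^+ j = 2 :> R by rewrite exprS -mulrA [2 ^+ j * _]mulrC hK mulr1.
  apply/andP; split.
    by rewrite -[leLHS]h1 ler_pM2l ?exprn_gt0//; exact: ltW.
  by rewrite -[leRHS]h2 ler_pM2l ?exprn_gt0.
- by move=> h; exists (n false) => //; rewrite !waveE.
- by move=> h; exists (n true) => //; rewrite !waveE.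
Qed.

Lemma prevalent_wave (s t : nat -> R) (G : set E) :
  (forall i, [/\ 0 < t i, 1 <= s i < t i + 1 & hausdorff_measure (t i) X <> 0%E]) ->
  (forall f : E, (forall i, ((s i)%:E <= dimH (graph f))%E) -> G f) ->
  prevalent G.
Proof.
move=> hi hG.
have /choice[z hz] : forall i, exists z : (R * R) * ((nat -> seq X) * (nat -> X -> R)),
  [/\ 0 < z.1.1, forall M p, 0 <= z.2.2 M p, forall M, z.1.1 <= \sum_(p <- z.2.1 M) z.2.2 M p &
    forall M B, admissible wave wave_gap B ->
     \sum_(p <- z.2.1 M) \sum_(q <- z.2.1 M) z.2.2 M p * z.2.2 M q *
       \sum_(k < M) ((2^-1 ^+ k) `^ s i)^-1 * B k p q <= z.1.2].
  move=> i; have [t0 st Ht] := hi i.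
  have [c [C [pts [w h]]]] := frostman_energy wave_gap_gt0 wave_sep t0 st Ht.
  by exists ((c, C), (pts, w)).
apply: (@prevalent_of_separation _ _ _ cX wave wave_gap s (fun i => (z i).1.1)
  (fun i => (z i).1.2) (fun i => (z i).2.1) (fun i => (z i).2.2)) hG => //.
- exact: wave_le1.
- exact: wave_gap_gt0.
- move=> i; have [? ? ? _] := hz i; split => //.
  by have [_ /andP[s1 _] _] := hi i; lra.
- by move=> i M B Badm; have [_ _ _] := hz i; apply.
Qed.

End waves.

(** * Uncountable sets *)

Section uncountable_split.
Context {R : realType}.
Implicit Types Z A : set R.

Lemma subset_countable (T : Type) (A B : set T) : A `<=` B -> countable B -> countable A.
Proof. by move=> AB; apply: sub_countable; exact: subset_card_le. Qed.

Lemma countable_setU (T : Type) (A B : set T) : countable A -> countable B -> countable (A `|` B).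
Proof.
move=> cA cB; rewrite -bigcup2inE; apply: bigcup_countable => // i _.
by rewrite /bigcup2; do 2 case: ifP => // _.
Qed.

(** Otherwise one side of every gap is countable. Let [s] be the supremum of the points with only
    countably much of [Z] to their left: the part of [Z] at any given positive distance or more from
    [s] is countable, and so is [Z]. *)
Lemma uncountable_split Z : ~ countable Z -> exists c d, c < d /\
  ~ countable (Z `&` [set x | x <= c]) /\ ~ countable (Z `&` [set x | d <= x]).
Proof.
move=> uZ; apply: contrapT => h.
have dich c d : c < d -> countable (Z `&` [set x | x <= c]) \/ countable (Z `&` [set x | d <= x]).
  move=> cd; apply: contrapT => /not_orP[h1 h2].
  by apply: h; exists c, d.
pose S := [set c | countable (Z `&` [set x | x <= c])].
have Sdown c c' : S c' -> c <= c' -> S c.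
  move=> Sc' cc'; apply: subset_countable Sc' => x [Zx /= xc]; split => //=.
  exact: le_trans cc'.
have bnd (x : R) : exists n : nat, `|x| <= n%:R.
  by exists (Num.truncn `|x|).+1; exact/ltW/truncnS_gt.
have [u Su] : exists u, ~ S u.
  apply: contrapT => /forallNP hS; apply: uZ.
  apply: (@subset_countable _ _ (\bigcup_n (Z `&` [set x | x <= n%:R]))).
    move=> x Zx; have [n xn] := bnd x; exists n => //; split => //=.
    exact: le_trans (ler_norm x) xn.
  apply: bigcup_countable => // n _; apply: contrapT; exact: hS.
have [v Sv] : exists v, S v.
  apply: contrapT => /forallNP hS; apply: uZ.
  apply: (@subset_countable _ _ (\bigcup_n (Z `&` [set x | - n%:R <= x]))).
    move=> x Zx; have [n xn] := bnd x; exists n => //; split => //=.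
    by move: xn; rewrite ler_norml => /andP[].
  apply: bigcup_countable => // n _.
  have lt : - n%:R - 1 < - n%:R :> R by lra.
  by have [/hS|] := dich _ _ lt.
have Sub : has_ubound S.
  exists u => c Sc; rewrite leNgt; apply/negP => uc; apply: Su.
  exact: Sdown Sc (ltW uc).
have Shas : has_sup S by split => //; exists v.
pose s := sup S.
apply: uZ; apply: (@subset_countable _ _ ([set s] `|` (\bigcup_n (
    (Z `&` [set x | x <= s - n.+1%:R^-1]) `|` (Z `&` [set x | s + n.+1%:R^-1 <= x]))))).
  move=> x Zx; have [->|xs] := eqVneq x s; [by left|right].
  have d0 : 0 < `|x - s| by rewrite normr_gt0 subr_eq0.
  have [n hn] := invS_lt d0; exists n => //.
  have [sx|sx] := leP s x.
    right; split => //=; move: hn; rewrite ger0_norm ?subr_ge0//.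
    by move: (n.+1%:R^-1) => a; lra.
  left; split => //=; move: hn; rewrite ltr0_norm ?subr_lt0//.
  by move: (n.+1%:R^-1) => a; lra.
apply: countable_setU; first exact: countable1.
apply: bigcup_countable => // n _.
have n0 : 0 < n.+1%:R^-1 :> R by rewrite invr_gt0.
apply: countable_setU.
  have [c Sc hc] := sup_adherent n0 Shas.
  exact: (Sdown _ _ Sc (ltW hc)).
have lt : s + n.+1%:R^-1 / 2 < s + n.+1%:R^-1.
  by move: (n.+1%:R^-1) n0 => a; lra.
have [Sc|//] := dich _ _ lt.
have := ub_le_sup Sub Sc; rewrite -/s => le.
by exfalso; move: (n.+1%:R^-1) n0 le => a; lra.
Qed.

Variable Z : set R.
Hypothesis Zunc : ~ countable Z.

Lemma split_choice : exists sp : set R -> R * R, forall A, ~ countable (Z `&` A) ->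
  [/\ (sp A).1 < (sp A).2, ~ countable (Z `&` A `&` [set x | x <= (sp A).1]) &
      ~ countable (Z `&` A `&` [set x | (sp A).2 <= x])].
Proof.
suff /choice[sp hsp] : forall A, exists cd : R * R, ~ countable (Z `&` A) ->
  [/\ cd.1 < cd.2, ~ countable (Z `&` A `&` [set x | x <= cd.1]) &
      ~ countable (Z `&` A `&` [set x | cd.2 <= x])] by exists sp.
move=> A.
have [cA|uA] := pselect (countable (Z `&` A)); first by exists (0, 0).
by have [c [d [? [? ?]]]] := uncountable_split uA; exists (c, d).
Qed.

(** Only uncountability is carried from cell to cell, to keep all of them nonempty; they need not
    shrink, since just one point with prescribed first [M] values is wanted. *)
Lemma binary_scheme : exists U : nat -> R -> R,
  [/\ forall j, continuous (U j), forall j x, 0 <= U j x <= 1 &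
      forall (a : nat -> bool) M, exists2 z, Z z & forall j, (j < M)%N -> U j z = (a j)%:R].
Proof.
have [sp hsp] := split_choice.
pose side A (b : bool) := if b then [set x | (sp A).2 <= x] else [set x | x <= (sp A).1].
(* The head of l is the last digit. *)
pose fix cellZ (l : seq bool) : set R :=
  if l is b :: l' then cellZ l' `&` side (cellZ l') b else setT.
have cellZ_unc l : ~ countable (Z `&` cellZ l).
  elim: l => [|b l IH] /=; first by rewrite setIT.
  have [_ h1 h2] := hsp _ IH; rewrite setIA /side.
  by case: b.
have cellZ_closed l : closed (cellZ l).
  elim: l => [|b l IH] /=; first exact: closedT.
  apply: closedI => //; rewrite /side; case: b; [exact: closed_ge|exact: closed_le].
have cellZ_disj l l' x : size l = size l' -> cellZ l x -> cellZ l' x -> l = l'.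
  elim: l l' => [|b l IH] [|b' l']//= [ll] [lx bx] [l'x b'x].
  have e := IH _ ll lx l'x; rewrite -e in b'x *.
  have [h _ _] := hsp _ (@cellZ_unc l).
  case: b b' bx b'x => -[]; rewrite /side/= => h1 h2 //.
    by have := le_trans h1 h2; rewrite leNgt h.
  by have := le_trans h2 h1; rewrite leNgt h.
(* A finite union of closed cells of depth [j.+1], those whose last digit is [b]; the unions for the
   two values of [b] are disjoint, so a Urysohn function reads off the digit. *)
pose side_set j b := \bigcup_(l in [set: j.-tuple bool]) cellZ (b :: l).
have side_closed j b : closed (side_set j b).
  apply: closed_bigcup => [|l _]; first exact: finite_finset.
  exact: cellZ_closed.
have side_disj j : side_set j false `&` side_set j true = set0.
  apply/seteqP; split => // x [[l _ lx] [l' _ l'x]].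
  have : false :: l = true :: l' by apply: cellZ_disj lx l'x; rewrite /= !size_tuple.
  by [].
have sepU j : uniform_separator (side_set j false) (side_set j true).
  by apply: (normal_uniform_separator pseudometric_normal).
pose U j := @Urysohn R R (side_set j false) (side_set j true).
exists U; split => [j|j x|a M].
- exact: Urysohn_continuous.
- have := @Urysohn_range R R (side_set j false) (side_set j true) (U j x).
  by move=> /(_ (ex_intro2 _ _ x I erefl)); rewrite /= in_itv.
pose fix path (n : nat) : seq bool := if n is n'.+1 then a n' :: path n' else [::].
have path_size n : size (path n) = n by elim: n => //= n ->.
have [z [Zz Mz]] : (Z `&` cellZ (path M)) !=set0.
  by apply/set0P/eqP => e; apply: (@cellZ_unc (path M)); rewrite e.
have pathz j : (j <= M)%N -> cellZ (path j) z.
  move: Mz; elim: M => [|M IH]; first by rewrite leqn0 => ? /eqP ->.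
  move=> Mz; rewrite leq_eqVlt => /orP[/eqP ->//|].
  by rewrite ltnS; apply: IH; have [] := Mz.
exists z => // j jM.
have zs : side_set j (a j) z.
  have pj : size (path j) == j by rewrite path_size.
  by exists (Tuple pj) => //; exact: (pathz j.+1 jM).
move: zs; case: (a j) => zs.
- by apply: (@Urysohn_sub1 R R _ _ (sepU j)); exists z.
- by apply: (@Urysohn_sub0 R R _ _ (sepU j)); exists z.
Qed.

End uncountable_split.

(** * Digit functions on an uncountable compact set *)

Section digits.
Context {R : realType} {m : nat} {X : set 'rV[R]_m} (cX : compact X).
Local Notation E := (C1 R cX).

(** If all coordinate projections were countable, [X] would inject into a finite product of copies
    of [nat]. *)
Lemma uncountable_coord : ~ countable X ->
  exists i : 'I_m, ~ countable [set (x : 'rV[R]_m) 0 i | x in X].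
Proof.
move=> uX; apply: contrapT => /forallNP h; apply: uX.
have /choice[code hcode] : forall i, exists g : R -> nat,
    {in [set (x : 'rV[R]_m) 0 i | x in X] &, injective g}.
  by move=> i; apply/countable_injP; apply: contrapT; exact: h.
apply/countable_injP.
exists (fun x : 'rV[R]_m => pickle [ffun i => code i (x 0 i)]) => x y.
rewrite !inE => Xx Xy /(pcan_inj pickleK)/ffunP e.
apply/rowP => i; have := e i; rewrite !ffunE; apply: hcode; rewrite inE.
  by exists x.
by exists y.
Qed.

Lemma digit_functions : ~ countable X -> exists psi : nat -> E,
  (forall j, `|psi j| <= 1) /\
  forall (a : nat -> bool) M, exists x : X, forall j, (j < M)%N -> psi j x = (a j)%:R :> R.
Proof.
move=> /uncountable_coord[i /binary_scheme[U [cU U01 hU]]].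
pose g j (x : X) : R := U j ((set_val x : 'rV[R]_m) 0 i).
have cont j : continuous (g j).
  move=> x; apply: (@continuous_comp _ _ _ (fun x : X => (set_val x : 'rV[R]_m) 0 i) (U j)).
    apply: (@continuous_comp _ _ _ (set_val : X -> 'rV[R]_m) (fun M : 'rV[R]_m => M 0 i)).
      exact: initial_continuous.
    exact: coord_continuous.
  exact: cU.
exists (fun j => exist _ (g j) ((contpredP _).2 (cont j)) : E); split => [j|a M].
  apply: C1_norm_le => // x; rewrite /C1_fun/=.
  by have /andP[h1 h2] := U01 j ((set_val x : 'rV[R]_m) 0 i); rewrite ger0_norm.
have [_ [y Xy <-] hy] := hU a M.
by exists (exist _ y (mem_set Xy)) => j jM; exact: hy.
Qed.

(** The index of the separating function is unrelated to distances, so all scales [k < M] are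
    summed, which stays bounded because [s < 1]; the 2^-j share of the strings that agree in [j]
    digits outweighs the polynomial loss. *)
Lemma digit_energy (psi : nat -> E) (s : R) : 0 <= s < 1 ->
  (forall (a : nat -> bool) M, exists x : X, forall j, (j < M)%N -> psi j x = (a j)%:R :> R) ->
  exists (C : R) (pts : nat -> seq X) (w : nat -> X -> R),
  [/\ forall M p, 0 <= w M p, forall M, 1 <= \sum_(p <- pts M) w M p &
    forall M B, admissible psi 2^-1 B ->
     \sum_(p <- pts M) \sum_(q <- pts M) w M p * w M q *
       \sum_(k < M) ((2^-1 ^+ k) `^ s)^-1 * B k p q <= C].
Proof.
move=> /andP[s0 s1] hpsi.
pose ext M (a : {ffun 'I_M -> bool}) (j : nat) : bool :=
  if insub j is Some i then a i else false.
have /choice[pt hpt] : forall (Ma : {M & {ffun 'I_M -> bool}}), exists x : X,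
    forall j : 'I_(tag Ma), psi j x = (tagged Ma j)%:R :> R.
  move=> [M a]; have [x hx] := hpsi (ext M a) M.
  by exists x => j; rewrite /= hx// /ext valK.
pose h : R := 2^-1; have h01 : 0 < h by rewrite /h.
pose pts M := [seq pt (Tagged (fun M => {ffun 'I_M -> bool}) a) | a <- enum {ffun 'I_M -> bool}].
pose w (M : nat) (_ : X) := h ^+ M.
have [C3 hC3] : exists C, forall M, \sum_(j < M) j.+2%:R ^+ 3 * h ^+ j <= C :> R.
  by apply: poly_geometric_bounded; rewrite h01 /h; lra.
pose rho : R := 2^-1 `^ (1 - s).
have /andP[rho0 rho1] : 0 < rho < 1 by apply: half_pow_lt1; lra.
pose G := (1 - rho)^-1.
have G0 : 0 <= G by rewrite invr_ge0; lra.
have mass (M : nat) (P : pred {ffun 'I_M -> bool}) (Q : pred X) :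
    (forall a, Q (pt (Tagged (fun M => {ffun 'I_M -> bool}) a)) -> P a) ->
    \sum_(p <- pts M | Q p) w M p <= h ^+ M * #|P|%:R.
  move=> QP; rewrite big_map big_enum_cond/=.
  rewrite /w sumr_const -[leLHS]mulr_natr; apply: ler_wpM2l; first by rewrite exprn_ge0// ltW.
  by rewrite ler_nat; apply: subset_leq_card; apply/fintype.subsetP => a; exact: QP.
exists (G * (10 * C3 + 1)), pts, w; split => [M p|M|M B [B01 B0 Bsep]].
- by rewrite exprn_ge0// ltW.
- rewrite big_map big_enum/= /w sumr_const card_ffun card_bool card_ord -[leRHS]mulr_natr natrX.
  by rewrite -exprMn /h mulVf// expr1n.
pose sep j (p q : X) := 2^-1 <= `|psi j p - psi j q|.
(* For a pair that is never separated only [B <= 1] is left: the term at scale [k] is then at most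
   2^k rho^k, hence at most 2^M rho^k. *)
pose tau j := if (j < M)%N then 10 * (j.+1%:R * j.+2%:R) * G else (h ^+ M)^-1 * G.
pose theta j := h ^+ j.
have w0 p : 0 <= w M p by rewrite exprn_ge0// ltW.
have tau0 j : 0 <= tau j.
  rewrite /tau; case: ifP => _; apply: mulr_ge0 => //.
  by rewrite invr_ge0 exprn_ge0// ltW.
have Ksep j p q : (j < M)%N -> unsep sep j p q -> sep j p q ->
    \sum_(k < M) ((2^-1 ^+ k) `^ s)^-1 * B k p q <= tau j.
  move=> jM _ sj; rewrite /tau jM.
  apply: (@le_trans _ _ (\sum_(k < M) 10 * (j.+1%:R * j.+2%:R) * rho ^+ k)); last first.
    rewrite -mulr_sumr; apply: ler_wpM2l; first by apply: mulr_ge0 => //; rewrite mulr_ge0.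
    by apply: geometric_le; rewrite ltW.
  apply: ler_sum => k _.
  apply: (@le_trans _ _ (((2^-1 ^+ k) `^ s)^-1 * (10 * (j.+1%:R * j.+2%:R) * 2^-1 ^+ k))).
    apply: ler_wpM2l; first by rewrite invr_ge0 powR_ge0.
    by apply: le_trans (Bsep k p q j sj) _; rewrite invrK (_ : 5 * 2 = 10 :> R) //; lra.
  rewrite mulrCA half_pow_split; apply: ler_wpM2l.
    by apply: mulr_ge0 => //; rewrite mulr_ge0.
  by rewrite -powRN opprB half_powE.
have Kun p q : unsep sep M p q ->
    \sum_(k < M) ((2^-1 ^+ k) `^ s)^-1 * B k p q <= tau M.
  move=> _; rewrite /tau ltnn.
  apply: (@le_trans _ _ (\sum_(k < M) (h ^+ M)^-1 * rho ^+ k)); last first.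
    rewrite -mulr_sumr; apply: ler_wpM2l; first by rewrite invr_ge0 exprn_ge0// ltW.
    by apply: geometric_le; rewrite ltW.
  apply: ler_sum => k _; have /andP[Bk0 Bk1] := B01 k p q.
  apply: (@le_trans _ _ (((2^-1 ^+ k) `^ s)^-1)).
    by rewrite -[leRHS]mulr1; apply: ler_wpM2l => //; rewrite invr_ge0 powR_ge0.
  have hk : 0 < h ^+ k by rewrite exprn_gt0.
  rewrite (_ : _^-1 = (h ^+ k)^-1 * rho ^+ k); last first.
    rewrite -half_powE -/h -opprB powRN -half_pow_split -/h [in RHS]mulrC mulfK ?gt_eqF//.
  apply: ler_wpM2r; first by rewrite exprn_ge0// ltW.
  rewrite lef_pV2 ?posrE ?exprn_gt0//; apply: ler_wiXn2l; rewrite /h; [lra|lra|exact: ltnW].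
have wth j p : (j <= M)%N -> \sum_(q <- pts M | unsep sep j p q) w M q <= theta j.
  move=> jM.
  (* Not being separated from [p] below [j] forces the first [j] digits to be the roundings of
     [psi i p] at 1/2, which leaves 2^(M - j) strings. *)
  pose F (i : 'I_M) : pred bool := fun b => (i < j)%N ==> (b == (2^-1 < psi i p)).
  apply: le_trans (mass M (mem (family F)) _ _) _.
    move=> a /allP un; apply/familyP => i; rewrite unfold_in /F; apply/implyP => ij.
    have := un i; rewrite mem_iota add0n ij => /(_ isT).
    rewrite /sep -ltNge (hpt (Tagged (fun M => {ffun 'I_M -> bool}) a) i)/=.
    move: (psi i p : R) => y; case: (a i) => hy; apply/eqP/esym.
      move: hy; rewrite mulr1n ltr_norml => /andP[h1 h2].
      by apply/idP; lra.
    move: hy; rewrite mulr0n subr0 ltr_norml => /andP[h1 h2].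
    by apply/negbTE; rewrite -leNgt; lra.
  rewrite card_family /theta foldrE big_map big_enum/=.
  rewrite (_ : \prod_(i < M) #|F i| = 2 ^ (M - j))%N; last first.
    have cF (i : 'I_M) : #|F i| = (if (i < j)%N then 1 else 2)%N.
      rewrite /F; case: ltnP => ij /=; last by rewrite -card_bool; apply: eq_card.
      by rewrite -[RHS](card1 (2^-1 < psi i p)); apply: eq_card.
    rewrite (eq_bigr _ (fun i _ => cF i)) -(subnKC jM) big_split_ord/=.
    rewrite big1 ?mul1n => [|i _]; last by rewrite ltn_ord.
    rewrite (eq_bigr (fun _ => 2)%N); last by move=> i _; rewrite ltnNge leq_addr.
    by rewrite prod_nat_const card_ord addKn.
  by rewrite natrX -{1}(subnKC jM) exprD -mulrA -exprMn /h mulVf// expr1n mulr1 lexx.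
apply: (le_trans (pair_sum_bound w0 tau0 Ksep Kun wth)).
have S0 : 0 <= \sum_(j < M.+1) tau j * theta j.
  by apply: sumr_ge0 => j _; rewrite mulr_ge0// exprn_ge0// ltW.
apply: (@le_trans _ _ (1 * \sum_(j < M.+1) tau j * theta j)).
  apply: ler_wpM2r => //; apply: le_trans (mass M predT predT _) _ => //.
  by rewrite card_ffun card_bool card_ord natrX -exprMn /h mulVf// expr1n.
rewrite mul1r big_ord_recr/= mulrDr mulr1; apply: lerD; last first.
  by rewrite /tau ltnn /theta mulrAC mulVf ?mul1r// gt_eqF// exprn_gt0.
apply: (@le_trans _ _ (G * (10 * \sum_(j < M) j.+2%:R ^+ 3 * h ^+ j))); last first.
  by apply: ler_wpM2l => //; apply: ler_wpM2l => //; exact: hC3.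
rewrite !mulr_sumr; apply: ler_sum => j _; rewrite /tau ltn_ord /theta.
have hj : 0 < h ^+ j by rewrite exprn_gt0.
rewrite mulrAC [leLHS]mulrC; apply: ler_wpM2l => //.
rewrite -mulrA; apply: ler_wpM2l => //; apply: ler_wpM2r; first exact: ltW.
by rewrite -natrM -natrX ler_nat; nia.
Qed.

Lemma prevalent_digit (s : nat -> R) (G : set E) : ~ countable X ->
  (forall i, 0 <= s i < 1) ->
  (forall f : E, (forall i, ((s i)%:E <= dimH (graph f))%E) -> G f) ->
  prevalent G.
Proof.
move=> /digit_functions[psi [psi1 hpsi]] s01 hG.
have /choice[D hD] : forall i, exists D : R * (nat -> seq X) * (nat -> X -> R),
  [/\ forall M p, 0 <= D.2 M p, forall M, 1 <= \sum_(p <- D.1.2 M) D.2 M p &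
    forall M B, admissible psi 2^-1 B ->
     \sum_(p <- D.1.2 M) \sum_(q <- D.1.2 M) D.2 M p * D.2 M q *
       \sum_(k < M) ((2^-1 ^+ k) `^ s i)^-1 * B k p q <= D.1.1].
  move=> i; have [C [pts [w h]]] := digit_energy (s01 i) hpsi.
  by exists (C, pts, w).
apply: (@prevalent_of_separation R m X cX psi 2^-1 s (fun=> 1) (fun i => (D i).1.1)
  (fun i => (D i).1.2) (fun i => (D i).2)) => // [i|i M B Badm].
  by have [h1 h2 _] := hD i; split => //; have /andP[] := s01 i.
by have [_ _ h] := hD i; exact: h.
Qed.

End digits.

Lemma dimH_lt_fin {R : realType} {n : nat} (F : set 'rV[R]_n) (b : \bar R) :
  (dimH F < b)%E -> exists d : R, dimH F = d%:E.
Proof.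
have := dimH_ge0 F; case: (dimH F) => [d||]//; first by exists d.
by move=> _; rewrite ltNge leey.
Qed.

Section dimension.
Context {R : realType} {m : nat} {X : set 'rV[R]_m} (cX : compact X).
Local Notation E := (C1 R cX).

Lemma prevalent_digit_one : ~ countable X ->
  prevalent [set f : E | (1 <= dimH (graph f))%E].
Proof.
move=> uX; apply: (@prevalent_digit R m X cX (fun i => 1 - i.+1%:R^-1)) => // [i|f hf].
  have h0 : 0 < i.+1%:R^-1 :> R by rewrite invr_gt0.
  have h1 : i.+1%:R^-1 <= 1 :> R by rewrite invf_le1// ler1n.
  by move: (i.+1%:R^-1) h0 h1 => a; lra.
rewrite /= leNgt; apply/negP => lt.
have [d hd] := dimH_lt_fin lt.
rewrite hd lte_fin in lt.
have [i hi] : exists i : nat, i.+1%:R^-1 < 1 - d by apply: invS_lt; lra.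
by have := hf i; rewrite hd lee_fin; move: (i.+1%:R^-1) hi => a; lra.
Qed.

Lemma prevalent_wave_dimH (m_gt0 : (0 < m)%N) : (0 < dimH X)%E ->
  prevalent [set f : E | (dimH X + 1 <= dimH (graph f))%E].
Proof.
move=> X0.
pose ok (s : R) := 1 <= s /\ ((s - 1)%:E < dimH X)%E.
have ok1 : ok 1 by split => //; rewrite subrr.
(* An enumeration of the rational exponents that satisfy [ok], with default 1; it serves a finite
   and an infinite [dimH X] alike. *)
pose s i : R := if unpickle i is Some q then
   (if pselect (ok (ratr q)) then ratr q else 1) else 1.
have sok i : ok (s i) by rewrite /s; case: unpickle => // q; case: pselect.
have /choice[t ht] : forall i, exists t, s i - 1 < t /\ (t%:E < dimH X)%E.
  move=> i; have [_ h] := sok i.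
  have [b hb] : exists b : R, s i - 1 < b /\ (b%:E <= dimH X)%E.
    move: h; case: (dimH X) => [d||]//=; rewrite ?lte_fin => h.
      by exists d.
    by exists (s i); split; [lra|rewrite leey].
  exists ((s i - 1 + b) / 2); split; first by case: hb; lra.
  case: hb => h1 /(lt_le_trans _); apply; rewrite lte_fin; lra.
apply: (@prevalent_wave R m X cX m_gt0 s t) => [i|f hf].
  have [s1 s2] := sok i; have [t1 t2] := ht i.
  split; [lra|by apply/andP; split; lra|].
  by apply: lt_dimH => //; lra.
rewrite /= leNgt; apply/negP => lt.
have [d hd] := dimH_lt_fin lt.
rewrite hd in lt.
have d1 : 1 <= d by have := hf 0%N; rewrite hd lee_fin; apply: le_trans; have [] := sok 0%N.
have [b [db hb]] : exists b : R, d < b /\ (b%:E <= dimH X + 1)%E.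
  move: lt; case: (dimH X + 1)%E => [b||]//=; rewrite ?lte_fin => h; first by exists b.
  by exists (d + 1); split; [lra|rewrite leey].
have [q] := rat_in_itvoo db; rewrite in_itv/= => /andP[dq qb].
have okq : ok (ratr q).
  split; first lra.
  rewrite EFinB lteBlDr//; apply: lt_le_trans hb; by rewrite lte_fin.
have := hf (pickle q); rewrite hd /s pickleK; case: pselect => //= ?.
by rewrite lee_fin leNgt dq.
Qed.

End dimension.

Lemma prevalent_sub {R : realType} {E : completeNormedModType R} (A B : set E) :
  A `<=` B -> prevalent A -> prevalent B.
Proof. by move=> AB [S sS AS]; exists S => // x Bx; apply: AS => Ax; apply: Bx; exact: AB. Qed.

Theorem theorem1p10 (R : realType) (m : nat) (hm : (0 < m)%N)
    (X : set 'rV[R]_m) (cX : compact X) :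
  (~ countable X ->
     prevalent [set f : C1 R cX | dimH (graph f) = (dimH X + 1)%E]) /\
  (countable X -> forall f : C1 R cX, dimH (graph f) = 0%E).
Proof.
split=> [uX|cntX f]; last exact: dimH_graph_countable.
apply: (@prevalent_sub _ _ [set f : C1 R cX | (dimH X + 1 <= dimH (graph f))%E]).
  move=> f hf; apply/eqP; rewrite eq_le; apply/andP; split; last exact: hf.
  apply: dimH_graph_le; exists (C1_norm f) => x; exact: C1_norm_ge.
have [X0|] := ltP 0%E (dimH X); first exact: prevalent_wave_dimH.
move=> X0; have -> : dimH X = 0%E by apply/eqP; rewrite eq_le X0 dimH_ge0.
by rewrite add0e; exact: prevalent_digit_one.
Qed.
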